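(* Let $X$ be a local vector field on $\mathbb{C}^\nu$ with diagonal linear part $X_{\rm lin}=\sum_{i=1}^\nu\lambda_ix_i\partial_{x_i}$, $X=X_{\rm lin}+\sum_{n\in A(X)}D_n$. The Poincaré–Dulac normal form $X_{tram}$ of $X$, i.e. the limit of the iterated simplified fields $X\to X_{sam}^1\to X_{sam}^2\to\cdots\to X_{tram}$, is a continuous prenormal form, and it has a mould expansion $$X_{tram}=X_{\rm lin}+\sum_{\underline{s}\in A^*(X)}Tram^{\underline{s}}D_{\underline{s}}$$ for a mould $Tram^\bullet$ on $A(X)$.
   Context: Write $X-X_{\rm lin}=\sum_{n\in A(X)}D_n$ where each $D_n$ is a non-zero derivation of $\mathbb{C}[[x]]$, homogeneous of degree $n=(n_1,\dots,n_\nu)$, i.e. $D_n(x^m)=c_{n,m}x^{n+m}$, $c_{n,m}\in\mathbb{C}$ (all $n_i\ge0$ except at most one equal to $-1$; $\sum n_i\ge1$). $A(X)$ is the set of degrees occurring, $A^*(X)$ the set of finite sequences of elements of $A(X)$, and $D_{\underline{s}}=D_{s_1}\cdots D_{s_r}$ for $\underline{s}=(s_1,\dots,s_r)$. A mould on $A(X)$ is a complex-valued function on $A^*(X)$. Simplified field: with $\lambda=(\lambda_1,\dots,\lambda_\nu)$ and $\Theta=\sum_{n\in A(X),\ n\cdot\lambda\ne0}\frac{D_n}{n\cdot\lambda}$, put $X_{sam}=\exp(\Theta)\,X\,\exp(-\Theta)$. Iterating: $X_{sam}^1=X_{sam}$, and $X_{sam}^{k+1}$ is the simplified field of $X_{sam}^k$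 (using the decomposition of $X_{sam}^k-X_{\rm lin}$ into homogeneous derivations). $X_{tram}$ is the formal limit of $X_{sam}^k$ as $k\to\infty$ (coefficientwise). A prenormal form is a field $X_{\rm pran}=X_{\rm lin}+X_r$ with $[X_{\rm lin},X_r]=0$. It is called continuous if it depends continuously on the operators $D_n$, $n\in A(X)$, the spectrum $\lambda$ being fixed (for formal fields, continuity is understood coefficientwise). *)

(* Defs.v *)
From HB Require Import structures.
From mathcomp Require Import all_boot all_order all_algebra.
From mathcomp Require Import complex.
From mathcomp Require Import all_classical all_reals all_analysis.

Set Implicit Arguments.
Unset Strict Implicit.
Unset Printing Implicit Defensive.

Import Order.TTheory GRing.Theory Num.Theory.
Import numFieldNormedType.Exports.

Local Open Scope classical_set_scope.
Local Open Scope ring_scope.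

(* Vector fields are taken in the formal category: a formal vector field at   *)
(* the origin of C^nu is a derivation of C[[x]], seen as an operator on       *)
(* C[[x]].  A germ of analytic vector field is a particular case.             *)

Section FormalSeries.
Context (R : realType) (nu : nat).

Definition mono := {ffun 'I_nu -> nat}.

Definition degree := {ffun 'I_nu -> int}.

(* C[[x]], as families of coefficients.  The structure R[i]^o is that of C    *)
(* viewed as a normed space over itself.                                      *)
Definition fps := mono -> R[i]^o.

Definition op := fps -> fps.

Definition degm (m : mono) : degree := [ffun i => (m i)%:Z].

Definition degX (i : 'I_nu) : degree := [ffun j => (j == i)%:Z].

(* x^n for n in Z^nu, with the convention that x^n = 0 if some n_i < 0. *)
Definition xpow (n : degree) : fps := fun p => (n == degm p)%:R.

Definition fpsM (f g : fps) : fps := fun p =>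
  \sum_(q \in [set q : mono * mono | degm q.1 + degm q.2 = degm p])
     f q.1 * g q.2.

Definition partial (i : 'I_nu) : op := fun f p =>
  f [ffun j => p j + (j == i)]%N *+ (p i).+1.

Definition is_derivation (D : op) :=
  linear D /\ forall f g, D (fpsM f g) = fpsM (D f) g + fpsM f (D g).

Definition homogeneous (n : degree) (D : op) :=
  forall m : mono, exists c : R[i], D (xpow (degm m)) = c *: xpow (n + degm m).

(* Sums of families of operators are computed coefficientwise.  The sum \sum_ *)
(* over a set is only meaningful (and is otherwise 0) for finite support,     *)
(* whence the notion of summability.                                          *)
Definition op_summable (I : choiceType) (P : set I) (F : I -> op) :=
  forall (f : fps) (p : mono), finite_set [set i | P i /\ F i f p != 0].

Definition op_sum (I : choiceType) (P : set I) (F : I -> op) : op :=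
  fun f p => \sum_(i \in P) F i f p.

Definition op_exp (T : op) : op :=
  op_sum [set: nat] (fun k f => (k`!%:R)^-1 *: iter k T f).

(* The homogeneous component of degree n of U, characterized by the fact that *)
(* it maps x^m to c x^(n+m), c being the coefficient of x^(n+m) in U(x^m).    *)
(* The sum has at most one term, m = p - n.  For a derivation U, these        *)
(* components are the unique homogeneous derivations of which U is the sum.   *)
Definition hcomp (n : degree) (U : op) : op := fun f p =>
  \sum_(m \in [set m : mono | n + degm m = degm p]) f m * U (xpow (degm m)) p.

Definition commutator (U V : op) : op := (U \o V) - (V \o U).

End FormalSeries.

Section Fields.
Context (R : realType) (nu : nat) (lambda : 'I_nu -> R[i]).
Local Notation degree := (degree nu).
Local Notation op := (op R nu).
Local Notation mono := (mono nu).
Local Notation fps := (fps R nu).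

Definition Xlin : op := fun f =>
  \sum_(i < nu) lambda i *: fpsM (@xpow R nu (degX i)) (partial i f).

(* X(x_i) = lambda_i x_i + terms of total degree at least 2. *)
Definition local_field (X : op) :=
  is_derivation X /\
  forall (i : 'I_nu) (p : mono), (\sum_(j < nu) p j <= 1)%N ->
    X (xpow R (degX i)) p = lambda i * xpow R (degX i) p.

(* The operators D_n of X and the set A(X) of the degrees that occur. *)
Definition Dop (X : op) (n : degree) : op := hcomp n (X - Xlin).

Definition degrees (X : op) : set degree := [set n | Dop X n != 0].

Definition dotp (n : degree) : R[i] := \sum_(i < nu) (n i)%:~R * lambda i.

Definition Theta (X : op) : op :=
  op_sum [set n | degrees X n /\ dotp n != 0]
    (fun n f => (dotp n)^-1 *: Dop X n f).

Definition Xsam (X : op) : op :=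
  op_exp (Theta X) \o X \o op_exp (- Theta X).

Definition Xsam_iter (k : nat) (X : op) : op := iter k Xsam X.

Definition Xtram (X : op) : op := fun f p =>
  lim (Xsam_iter k X f p @[k --> \oo]).

Definition prenormal_form (Y : op) :=
  local_field Y /\ commutator Xlin (Y - Xlin) = 0.

(* Families (D_n) of operators with the topology of coefficientwise           *)
(* convergence: all D_n(f) converge coefficientwise.                          *)
Definition op_family := {ptws degree -> {ptws fps -> {ptws mono -> R[i]^o}}}.

Definition homogeneous_family (A : set degree) : set op_family :=
  [set D | forall n, A n -> is_derivation (D n) /\ homogeneous n (D n)].

Definition field_of (A : set degree) (D : op_family) : op :=
  Xlin + op_sum A (fun n => D n).

(* A procedure P assigning a field to each field of spectrum lambda depends   *)
(* continuously on the operators of degree in A if each coefficient of its    *)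
(* value is a continuous function of the family (D_n).                        *)
Definition depends_continuously (A : set degree) (P : op -> op) :=
  forall (f : fps) (p : mono),
    {within homogeneous_family A,
      continuous (fun D : op_family => P (field_of A D) f p : R[i]^o)}.

Definition mould (A : set degree) := seq A -> R[i].

Definition Dword (X : op) (s : seq (degrees X)) : op :=
  foldr (fun n U => Dop X (val n) \o U) id s.

Definition mould_expansion (X Y : op) (M : mould (degrees X)) :=
  let F := fun (s : seq (degrees X)) (f : fps) => M s *: Dword s f in
  op_summable setT F /\ Y = Xlin + op_sum setT F.

End Fields.

Arguments Dword {R nu} lambda X s.
Arguments mould_expansion {R nu} lambda X Y M.

(* Main.v *)
Require Import Defs.
From mathcomp Require Import all_boot all_order all_algebra.
From mathcomp Require Import complex zify.
From mathcomp Require Import all_classical all_reals all_analysis.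

Import Order.TTheory GRing.Theory Num.Theory.
Import numFieldNormedType.Exports.

Local Open Scope classical_set_scope.
Local Open Scope ring_scope.

(** Let A be a set of degrees of positive total degree, D a family of
    homogeneous derivations D_n (n in A), and X = X_lin + sum of the D_n.  The
    proof computes with moulds M, that is with noncommutative formal power
    series in the letters n in A, through the substitution
    Phi(M) = sum over words s of M^s D_s.

    All operators in sight are triangular: for the total degree, the
    coefficient at x^p of the image of f depends only on the coefficients of f
    of total degree at most that of p.  Each D_n raises the total degree, so
    only finitely many words contribute to a given coefficient; hence Phi(M) is
    defined for every mould (mould_summable) and Phi maps the product of moulds
    to composition (mould_sum_mul), exponentials to exponentials
    (mould_sum_exp), and the multiplication of M^s by a function of the degree
    of s to the multiplication of the homogeneous components of Phi(M) by that
    function (mould_sum_weighted).  As the commutator of X_lin with a component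
    of degree n is n.lambda times that component, Theta and exp(Theta) are
    images of explicit moulds, and the simplified field of X_lin + Phi(M) is
    X_lin + Phi(msam M) (Xsam_mould).  So there are moulds M_k, depending only
    on lambda and A, with X_sam^k = X_lin + Phi(M_k) for every family D
    (Xsam_iter_mould).

    Convergence is a statement on M_k, for the filtration by the length of
    words.  If the nonresonant part of M (the values at words s with s.lambda
    nonzero) vanishes on words of length at most d, then the mould T of Theta
    does too, and exp(T) (X_lin + M) exp(-T) = X_lin + M + [T, X_lin] + ...
    agrees with the resonant part of M up to length d + 1 (msam_first_order).
    By induction M_k is resonant up to length k, and M_(k+1) agrees with M_k
    there.  Put Tram^s = M_k^s for any k at least the length of s.  This mould
    vanishes at nonresonant words, so Phi(Tram) commutes with X_lin; and since
    words of length more than |p| do not contribute to the coefficient at x^p,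
    the sequence of the X_sam^k is stationary at each coefficient, with limit
    X_lin + Phi(Tram).  Finitely many words being involved and Tram not
    depending on D, each coefficient of the limit is a polynomial in finitely
    many coefficients of the D_n, whence the continuity.

    The limit is a derivation because each X_sam^k is one: exp(Theta) is an
    automorphism of the algebra of formal series (op_exp_mul) with inverse
    exp(-Theta) (op_expK).  That the coefficients of the image of f under a
    derivation depend on finitely many coefficients of f is not part of the
    definition of derivations; it follows from the Leibniz rule
    (derivation_order). *)

(** * Monomials and their total degree *)

Section Monomials.
Set Implicit Arguments.
Unset Strict Implicit.
Context (nu : nat).
Local Notation mono := (mono nu).
Local Notation degree := (degree nu).

Definition tdeg (m : mono) : nat := \sum_(i < nu) m i.

Definition tdegz (n : degree) : int := \sum_(i < nu) n i.

(** Sums over C[[x]] at a coefficient of total degree at most N are computed over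
    this list, so that they become ordinary finite sums. *)
Definition monos (N : nat) : seq mono :=
  [seq m <- [seq [ffun i => (h i : nat)] | h : {ffun 'I_nu -> 'I_N.+1}]
     | (tdeg m <= N)%N].

Lemma mono_le_tdeg (m : mono) i : (m i <= tdeg m)%N.
Proof. by rewrite /tdeg (bigD1 i) //= leq_addr. Qed.

Lemma mem_monos N m : (m \in monos N) = (tdeg m <= N)%N.
Proof.
rewrite mem_filter; case: leqP => //= le_mN; apply/mapP.
exists [ffun i => inord (m i)]; rewrite ?mem_enum //.
apply/ffunP => i; rewrite !ffunE inordK //.
by rewrite ltnS (leq_trans (mono_le_tdeg m i)).
Qed.

Lemma uniq_monos N : uniq (monos N).
Proof.
rewrite filter_uniq // map_inj_uniq ?enum_uniq // => h h' /ffunP e.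
by apply/ffunP => i; apply: val_inj; have := e i; rewrite !ffunE.
Qed.

Lemma degm_inj : injective (@degm nu).
Proof.
by move=> m m' /ffunP e; apply/ffunP => i; have := e i; rewrite !ffunE => -[].
Qed.

Lemma degmD (a b : mono) : degm (a + b) = degm a + degm b.
Proof. by apply/ffunP => i; rewrite !ffunE natrDE PoszD. Qed.

Lemma tdegz_degm (m : mono) : tdegz (degm m) = (tdeg m)%:Z.
Proof.
rewrite /tdegz /tdeg; elim/big_rec2: _ => // i x y _ ->.
by rewrite ffunE PoszD.
Qed.

Lemma tdegzD (a b : degree) : tdegz (a + b) = tdegz a + tdegz b.
Proof. by rewrite /tdegz -big_split; apply: eq_bigr => i _; rewrite ffunE. Qed.

Lemma tdeg_lt (n : degree) (m p : mono) :
  0 < tdegz n -> n + degm m = degm p -> (tdeg m < tdeg p)%N.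
Proof.
move=> n_gt0 /(congr1 tdegz); rewrite tdegzD !tdegz_degm => e.
by rewrite -ltz_nat -e ltrDr.
Qed.

Lemma tdeg_add (a b p : mono) :
  degm a + degm b = degm p -> (tdeg a + tdeg b = tdeg p)%N.
Proof.
by move/(congr1 tdegz); rewrite tdegzD !tdegz_degm -PoszD => -[].
Qed.

End Monomials.

(** * Finite sums *)

Section Sums.
Set Implicit Arguments.
Unset Strict Implicit.

Lemma fsbig_list (T : choiceType) (V : nmodType) (P : set T) (F : T -> V)
    (r : seq T) :
  uniq r -> (forall x, P x -> F x != 0 -> x \in r) ->
  \sum_(x \in P) F x = \sum_(x <- r | x \in P) F x.
Proof.
move=> r_uniq supp.
rewrite -(fsbig_widen (P `&` [set` r]) P); last 2 first.
- exact: subIsetl.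
- move=> x [Px /= /not_andP[//|xr]]; apply/eqP/negPn/negP => Fx0.
  by apply: xr; apply: supp.
rewrite (@fsbigE _ _ _ _ _ [seq x <- r | x \in P]) ?filter_uniq //.
- rewrite big_filter_cond big_seq_cond [RHS]big_seq_cond.
  apply: eq_bigl => x; rewrite in_setI.
  have -> : (x \in [set` r]) = (x \in r).
    by apply/idP/idP => [/set_mem|xr] //; exact: mem_set.
  by case: (x \in r); rewrite ?andbT ?andbb ?andbF.
- by move=> x /=; rewrite mem_filter => /andP[/set_mem].
- move=> x [Px /= xr]; rewrite mem_filter xr andbT => /negP[]; exact: mem_set.
Qed.

Lemma sum_pick (T : eqType) (V : nmodType) (r : seq T) (x0 : T) (F : T -> V) :
  uniq r -> x0 \in r -> (forall x, x \in r -> x != x0 -> F x = 0) ->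
  \sum_(x <- r) F x = F x0.
Proof.
move=> r_uniq x0r F0; rewrite (bigD1_seq x0) //= big_seq_cond big1 ?addr0 //.
by move=> x /andP[]; exact: F0.
Qed.

Lemma sum_triangle (V : nmodType) (N : nat) (F : nat -> nat -> V) :
  (forall i j, (N <= i + j)%N -> F i j = 0) ->
  \sum_(i < N) \sum_(j < N) F i j = \sum_(k < N) \sum_(i < k.+1) F i (k - i)%N.
Proof.
move=> F0.
transitivity (\sum_(k < N) \sum_(i < N | (i <= k)%N) F i (k - i)%N); last first.
  apply: eq_bigr => k _.
  by rewrite (big_ord_widen_cond N xpredT (fun i => F i (k - i)%N)).
rewrite [RHS](exchange_big_dep xpredT) //=; apply: eq_bigr => i _.
rewrite -(big_mkord xpredT (fun j => F i j)).
rewrite -(big_mkord (fun k => i <= k)%N (fun k => F i (k - i)%N)).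
have iN := ltnW (ltn_ord i).
rewrite [RHS](@big_cat_nat _ _ _ i) //= [X in _ = X + _]big_nat_cond.
rewrite [X in _ = X + _]big1 ?add0r; last first.
  by move=> k /andP[/= ki]; rewrite leqNgt ki.
rewrite -{2}(add0n (val i)) big_addn (big_cat_nat _ (n := N - i)) ?leq_subr //=.
rewrite [X in _ + X]big_nat_cond [X in _ + X]big1 ?addr0; last first.
  by move=> j /andP[/andP[jN _] _]; apply: F0; rewrite -leq_subLR.
by apply: eq_big => [j|j _]; rewrite ?leq_addl ?addnK.
Qed.

End Sums.

(** * Formal series and their derivations *)

Section Operators.
Set Implicit Arguments.
Unset Strict Implicit.
Context (R : realType) (nu : nat).
Local Notation C := (R[i]).
Local Notation "f $[ p ]" := (f p : R[i]) (at level 2, only parsing).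
Local Notation mono := (mono nu).
Local Notation degree := (degree nu).
Local Notation fps := (fps R nu).
Local Notation op := (op R nu).
Local Notation "''x^' m" := (xpow R (degm m)) (at level 3, m at level 2).

Lemma xpowE (m p : mono) : ('x^m) p = (p == m)%:R :> C.
Proof. by rewrite /xpow (inj_eq (@degm_inj nu)) eq_sym. Qed.

Lemma addfpsE (f g : fps) p : (f + g) p = f$[p] + g$[p] :> C.
Proof. by []. Qed.

Lemma oppfpsE (f : fps) p : (- f) p = - f$[p] :> C.
Proof. by []. Qed.

Lemma scalefpsE (c : C) (f : fps) p : (c *: f) p = c * f$[p] :> C.
Proof. by []. Qed.

Lemma sumfpsE I (r : seq I) (P : pred I) (F : I -> fps) p :
  (\sum_(i <- r | P i) F i) p = \sum_(i <- r | P i) (F i)$[p] :> C.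
Proof. by elim/big_rec2: _ => // i y f _ <-. Qed.

Lemma addopE (U V : op) f p : (U + V) f p = (U f)$[p] + (V f)$[p] :> C.
Proof. by []. Qed.

Lemma oppopE (U : op) f p : (- U) f p = - (U f)$[p] :> C.
Proof. by []. Qed.

(** The bound N is free so that factors can be replaced, below total degree N,
    by others with the same coefficients, in all terms at once. *)
Lemma fpsM_monos N (f g : fps) (p : mono) : (tdeg p <= N)%N ->
  fpsM f g p = \sum_(a <- monos nu N) \sum_(b <- monos nu N)
    (degm a + degm b == degm p)%:R * (f$[a] * g$[b]) :> C.
Proof.
move=> pN; rewrite /fpsM.
rewrite (@fsbig_list _ _ _ _ [seq (a, b) | a <- monos nu N, b <- monos nu N]).
- rewrite big_mkcond big_allpairs /=; apply: eq_bigr => a _.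
  apply: eq_bigr => b _ /=; case: ifPn => [/set_mem /= ->|].
    by rewrite eqxx mul1r.
  move=> abp; case: eqP => [e|]; last by rewrite mul0r.
  by case/negP: abp; apply/mem_set.
- by rewrite allpairs_uniq ?uniq_monos // => -[? ?] [].
- move=> [a b] /= /tdeg_add e _; apply/allpairsP; exists (a, b).
  by rewrite !mem_monos /= !(leq_trans _ pN) // -e ?leq_addr ?leq_addl.
Qed.

Lemma fpsMDl (f f' g : fps) : fpsM (f + f') g = fpsM f g + fpsM f' g.
Proof.
apply/funext => p; rewrite addfpsE !(@fpsM_monos (tdeg p)) // -big_split.
apply: eq_bigr => a _; rewrite -big_split; apply: eq_bigr => b _.
by rewrite addfpsE /= mulrDl mulrDr.
Qed.

Lemma fpsMDr (f g g' : fps) : fpsM f (g + g') = fpsM f g + fpsM f g'.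
Proof.
apply/funext => p; rewrite addfpsE !(@fpsM_monos (tdeg p)) // -big_split.
apply: eq_bigr => a _; rewrite -big_split; apply: eq_bigr => b _.
by rewrite addfpsE /= mulrDr mulrDr.
Qed.

Lemma fpsMZl c (f g : fps) : fpsM (c *: f) g = c *: fpsM f g.
Proof.
apply/funext => p; rewrite scalefpsE !(@fpsM_monos (tdeg p)) // mulr_sumr.
apply: eq_bigr => a _; rewrite mulr_sumr; apply: eq_bigr => b _.
by rewrite scalefpsE -(mulrA (c : C)) [RHS]mulrCA.
Qed.

Lemma fpsMZr c (f g : fps) : fpsM f (c *: g) = c *: fpsM f g.
Proof.
apply/funext => p; rewrite scalefpsE !(@fpsM_monos (tdeg p)) // mulr_sumr.
apply: eq_bigr => a _; rewrite mulr_sumr; apply: eq_bigr => b _.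
by rewrite scalefpsE (mulrCA (f a)) [RHS]mulrCA.
Qed.

Lemma fpsM0l (f : fps) : fpsM 0 f = 0.
Proof. by have := fpsMZl 0 0 f; rewrite !scale0r. Qed.

Lemma fpsM0r (f : fps) : fpsM f 0 = 0.
Proof. by have := fpsMZr 0 f 0; rewrite !scale0r. Qed.

Lemma fpsM_X (i : 'I_nu) (h : fps) (p : mono) :
  fpsM (xpow R (degX i)) h p =
  if p i == 0%N then 0 else h [ffun j => (p j - (j == i))%N].
Proof.
pose e : mono := [ffun j => (j == i) : nat].
have -> : degX i = degm e by apply/ffunP => j; rewrite !ffunE.
rewrite (@fpsM_monos (tdeg p)) //.
have F0 a b : a != e -> (degm a + degm b == degm p)%:R * (('x^e)$[a] * h$[b]) = 0 :> C.
  by move=> ae; rewrite xpowE (negbTE ae) mul0r mulr0.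
have [p0|p0] := eqVneq.
  rewrite big1 // => a _; rewrite big1 // => b _.
  have [->|/F0 ->//] := eqVneq a e.
  case: eqP => [/ffunP/(_ i)|]; last by rewrite mul0r.
  by rewrite !ffunE eqxx p0 -PoszD.
pose q : mono := [ffun j => (p j - (j == i))%N].
have eq : degm e + degm q = degm p.
  apply/ffunP => j; rewrite !ffunE -PoszD subnKC //.
  by case: (eqVneq j i) => // ->; rewrite lt0n.
have [eN qN] : e \in monos nu (tdeg p) /\ q \in monos nu (tdeg p).
  by rewrite !mem_monos -(tdeg_add eq) leq_addr leq_addl.
rewrite (sum_pick (uniq_monos nu (tdeg p)) eN); last first.
  by move=> a _ /F0 ae; rewrite big1.
rewrite (sum_pick (uniq_monos nu (tdeg p)) qN); last first.
  move=> b _ bq; case: eqP => [|]; last by rewrite mul0r.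
  by rewrite -eq => /addrI/degm_inj ebq; rewrite ebq eqxx in bq.
by rewrite eq eqxx mul1r xpowE eqxx mul1r.
Qed.

(** X_lin is diagonal: x^p is an eigenvector of eigenvalue p.lambda. *)
Lemma XlinE (lambda : 'I_nu -> R[i]) (f : fps) (p : mono) :
  Xlin lambda f p = dotp lambda (degm p) * f$[p] :> C.
Proof.
rewrite /Xlin sumfpsE /dotp mulr_suml; apply: eq_bigr => i _.
rewrite scalefpsE fpsM_X ffunE [in RHS]mulrAC mulrC; congr (_ * _).
case: eqP => [->|/eqP p0]; first by rewrite mul0r.
rewrite /partial ffunE eqxx subn1 prednK ?lt0n // -mulr_natl pmulrn.
congr (_ * f _); apply/ffunP => j; rewrite !ffunE subnK //.
by case: (eqVneq j i) => // ->; rewrite lt0n.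
Qed.

Lemma dotpD (lambda : 'I_nu -> R[i]) (a b : degree) :
  dotp lambda (a + b) = dotp lambda a + dotp lambda b.
Proof.
rewrite /dotp -big_split; apply: eq_bigr => i _.
by rewrite ffunE intrD mulrDl.
Qed.

Lemma Xlin_derivation (lambda : 'I_nu -> R[i]) : is_derivation (Xlin lambda).
Proof.
split=> [c f g|f g]; apply/funext => p.
  rewrite addfpsE scalefpsE !XlinE addfpsE scalefpsE mulrDr.
  by congr (_ + _); rewrite -mulrCA.
rewrite addfpsE XlinE !(@fpsM_monos (tdeg p)) // mulr_sumr -big_split.
apply: eq_bigr => a _; rewrite mulr_sumr -big_split.
apply: eq_bigr => b _ /=; rewrite !XlinE.
case: eqP => [<-|]; last by rewrite !mul0r mulr0 addr0.
by rewrite dotpD !mul1r mulrDl mulrA; congr (_ + _); rewrite mulrCA.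
Qed.

Lemma linear_add (U : op) : linear U -> {morph U : f g / f + g}.
Proof. by move=> Ulin f g; have := Ulin 1 f g; rewrite !scale1r. Qed.

Lemma linear_zero (U : op) : linear U -> U 0 = 0.
Proof. 
by move=> Ulin; have := Ulin (-1) 0 0; rewrite scaler0 addr0 scaleN1r addNr.
Qed.

Lemma linear_scale (U : op) : linear U -> forall c f, U (c *: f) = c *: U f.
Proof.
by move=> Ulin c f; have := Ulin c f 0; rewrite (linear_zero Ulin) !addr0.
Qed.

Lemma linear_opp (U : op) : linear U -> {morph U : f / - f}.
Proof. by move=> Ulin f; rewrite -scaleN1r linear_scale // scaleN1r. Qed.

Lemma linear_sum (U : op) : linear U ->
  forall I (r : seq I) (F : I -> fps), U (\sum_(i <- r) F i) = \sum_(i <- r) U (F i).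
Proof.
move=> Ulin I r F.
exact: (big_morph U (linear_add Ulin) (linear_zero Ulin)).
Qed.

Lemma degm0 : degm (0 : mono) = 0.
Proof. by apply/ffunP => i; rewrite !ffunE. Qed.

Lemma tdeg0 : tdeg (0 : mono) = 0%N.
Proof. by rewrite /tdeg big1 // => i _; rewrite ffunE. Qed.

Lemma fpsM_1l (f : fps) : fpsM ('x^0) f = f.
Proof.
apply/funext => p; rewrite (@fpsM_monos (tdeg p)) //.
rewrite (sum_pick (x0 := 0)) ?uniq_monos ?mem_monos ?tdeg0 //; last first.
  by move=> a _ a0; rewrite big1 // => b _; rewrite xpowE (negbTE a0) mul0r mulr0.
rewrite (sum_pick (x0 := p)) ?uniq_monos ?mem_monos //.
  by rewrite xpowE degm0 add0r !eqxx !mul1r.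
by move=> b _ bp; rewrite xpowE degm0 add0r (inj_eq (@degm_inj nu)) (negbTE bp) mul0r.
Qed.

Lemma fpsM_1r (f : fps) : fpsM f ('x^0) = f.
Proof.
apply/funext => p; rewrite (@fpsM_monos (tdeg p)) //.
rewrite (sum_pick (x0 := p)) ?uniq_monos ?mem_monos //; last first.
  move=> a _ ap; rewrite big1 // => b _; rewrite xpowE.
  have [->|_] := eqVneq b 0; last by rewrite !mulr0.
  by rewrite degm0 addr0 (inj_eq (@degm_inj nu)) (negbTE ap) mul0r.
rewrite (sum_pick (x0 := 0)) ?uniq_monos ?mem_monos ?tdeg0 //.
  by rewrite xpowE degm0 addr0 !eqxx !mul1r mulr1.
by move=> b _ b0; rewrite xpowE (negbTE b0) !mulr0.
Qed.

Lemma derivation1 (D : op) : is_derivation D -> D ('x^0) = 0.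
Proof.
move=> [Dlin Dleib]; have := Dleib ('x^0) ('x^0).
by rewrite !fpsM_1l fpsM_1r => /eqP; rewrite eq_sym -subr_eq0 addrK => /eqP.
Qed.

(** By induction on p.  The constant term of f is removed, as D 1 = 0; then
    Euler's identity writes f as the sum of the x_i d_i F with F m = f m / |m|,
    and Leibniz splits D (x_i d_i F) into a term controlled by the order of
    D x_i and one with d_i F, at a smaller exponent.  The case e = 0 holds for
    every derivation, the case e = 2 for those without linear part. *)
Lemma derivation_order (D : op) (e : nat) : is_derivation D ->
  (forall i q, (tdeg q < e)%N -> D (xpow R (degX i)) q = 0) ->
  forall (p : mono) (f : fps),
    (forall m, (tdeg m + e <= (tdeg p).+1)%N -> f m = 0) -> D f p = 0.
Proof.
move=> Dder De p; have [Dlin Dleib] := Dder.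
have [k] := ubnP (tdeg p); elim: k p => // k IHk p pk f f_ord.
pose h := f - f 0 *: ('x^0).
have h0 m : (tdeg m == 0)%N || (tdeg m + e <= (tdeg p).+1)%N -> h m = 0.
  rewrite /h addfpsE oppfpsE scalefpsE xpowE; have [->|m0] := eqVneq m 0.
    by rewrite mulr1 subrr.
  rewrite mulr0 subr0; case/orP => [m0'|/f_ord //].
  case/eqP: m0; apply/ffunP => i; rewrite ffunE; apply/eqP.
  by rewrite -leqn0 -(eqP m0') mono_le_tdeg.
have -> : D f = D h.
  by rewrite /h linear_add // linear_opp // linear_scale // derivation1 // scaler0 subr0.
pose F : fps := fun m => (tdeg m)%:R^-1 * h$[m].
have F0 m : (tdeg m + e <= (tdeg p).+1)%N -> F m = 0.
  by move=> mp; rewrite /F h0 ?mp ?orbT // mulr0.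
have -> : h = Xlin (fun _ => 1) F.
  apply/funext => m; rewrite XlinE /F.
  have -> : dotp (fun=> 1) (degm m) = (tdeg m)%:R :> C.
    rewrite /dotp /tdeg natr_sum; apply: eq_bigr => i _.
    by rewrite mulr1 ffunE pmulrn.
  have [m0|m0] := eqVneq (tdeg m) 0%N; first by rewrite h0 ?m0 // !mulr0.
  by rewrite mulVKf // pnatr_eq0.
rewrite /Xlin linear_sum // sumfpsE big1 // => i _.
rewrite scale1r Dleib addfpsE.
have dF0 m : (tdeg m + e <= tdeg p)%N -> partial i F m = 0.
  move=> mp; rewrite /partial F0 ?mul0rn //.
  have -> : tdeg [ffun j => (m j + (j == i))%N] = (tdeg m).+1.
    rewrite /tdeg [LHS](eq_bigr (fun j => m j + (j == i))%N); last first.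
      by move=> j _; rewrite ffunE.
    have e1 : (\sum_(j < nu) (j == i) = 1)%N.
      by rewrite (bigD1 i) //= eqxx big1 // => j /negbTE ->.
    by rewrite big_split /= e1 addn1.
  by rewrite addSn ltnS.
rewrite (@fpsM_monos (tdeg p)) // big1 ?add0r; last first.
  move=> a _; rewrite big1 // => b _.
  case: eqP => [/tdeg_add abp|]; last by rewrite mul0r.
  have [ae|ea] := ltnP (tdeg a) e; first by rewrite De // mul0r mulr0.
  by rewrite dF0 ?mulr0 // -abp addnC leq_add2r.
rewrite fpsM_X; case: eqP => // /eqP p0.
set q : mono := [ffun j => _].
have qp : (tdeg q).+1 = tdeg p.
  rewrite /tdeg !(bigD1 (P := xpredT) i) //= ffunE eqxx -addSn subn1 prednK ?lt0n //.
  by congr addn; apply: eq_bigr => j /negbTE ji; rewrite ffunE ji subn0.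
by apply: IHk => [|m]; rewrite qp; [exact: pk|exact: dF0].
Qed.

(** A derivation, although only assumed linear, is determined by its values on
    monomials: D f at p depends on f up to total degree |p| + 1, by
    derivation_order. *)
Lemma derivation_expand (D : op) : is_derivation D -> forall N (f : fps) (p : mono),
  (tdeg p < N)%N -> D f p = \sum_(m <- monos nu N) f$[m] * (D ('x^m))$[p] :> C.
Proof.
move=> hD N f p pN; have [Dlin _] := hD.
have : D (f - \sum_(m <- monos nu N) f m *: ('x^m)) p = 0.
  apply: (@derivation_order _ 0) => // m; rewrite addn0 => mp.
  rewrite addfpsE oppfpsE sumfpsE (sum_pick (x0 := m) (uniq_monos nu N)).
  - by rewrite scalefpsE xpowE eqxx mulr1 subrr.
  - by rewrite mem_monos (leq_trans mp).
  - move=> a _ am; by rewrite scalefpsE xpowE eq_sym (negbTE am) mulr0.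
rewrite linear_add // linear_opp // linear_sum // addfpsE oppfpsE sumfpsE.
move/eqP; rewrite subr_eq0 => /eqP ->; apply: eq_bigr => m _.
by rewrite linear_scale.
Qed.

End Operators.

(** * Triangular operators and their homogeneous components *)

Section Triangular.
Set Implicit Arguments.
Unset Strict Implicit.
Context (R : realType) (nu : nat).
Local Notation C := (R[i]).
Local Notation "f $[ p ]" := (f p : R[i]) (at level 2, only parsing).
Local Notation mono := (mono nu).
Local Notation degree := (degree nu).
Local Notation fps := (fps R nu).
Local Notation op := (op R nu).
Local Notation "''x^' m" := (xpow R (degm m)) (at level 3, m at level 2).

(** The matrix of U in the basis of monomials has finite rows and is block lower
    triangular for the total degree.  Such operators are determined by their
    values on monomials and are closed under composition. *)
Definition triangular (U : op) := forall (f : fps) (p : mono),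
  U f p = \sum_(m <- monos nu (tdeg p)) f$[m] * (U ('x^m))$[p] :> C.

Lemma triangular_eq0 (U : op) (m p : mono) :
  triangular U -> (tdeg p < tdeg m)%N -> U ('x^m) p = 0.
Proof.
move=> Utri pm; rewrite Utri big_seq big1 // => a; rewrite mem_monos => ap.
rewrite xpowE; case: eqP => [am|_]; last by rewrite mul0r.
by rewrite -am ltnNge ap in pm.
Qed.

Lemma sum_monos (N : nat) (p : mono) (F : mono -> C) : (tdeg p <= N)%N ->
  (forall m, (tdeg p < tdeg m)%N -> F m = 0) ->
  \sum_(m <- monos nu N) F m = \sum_(m <- monos nu (tdeg p)) F m.
Proof.
move=> pN F0; rewrite (bigID (fun m => m \in monos nu (tdeg p))) /=.
rewrite [X in _ + X]big1 ?addr0; last first.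
  by move=> m; rewrite mem_monos -ltnNge; exact: F0.
rewrite -big_filter; apply: perm_big; apply: uniq_perm.
- by rewrite filter_uniq // uniq_monos.
- exact: uniq_monos.
- move=> m; rewrite mem_filter !mem_monos; case: leqP => //= mp.
  exact: leq_trans mp pN.
Qed.

Lemma triangularE (U : op) (N : nat) (f : fps) (p : mono) :
  triangular U -> (tdeg p <= N)%N ->
  U f p = \sum_(m <- monos nu N) f$[m] * (U ('x^m))$[p] :> C.
Proof.
move=> Utri pN; rewrite Utri (sum_monos pN) // => m pm.
by rewrite triangular_eq0 // mulr0.
Qed.

Lemma triangular_linear (U : op) : triangular U -> linear U.
Proof.
move=> Utri c f g; apply/funext => p.
rewrite addfpsE scalefpsE !Utri mulr_sumr -big_split.
by apply: eq_bigr => m _; rewrite addfpsE scalefpsE mulrDl -mulrA.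
Qed.

Lemma triangular_ext (U V : op) : triangular U -> triangular V ->
  (forall m p, U ('x^m) p = V ('x^m) p) -> U = V.
Proof.
move=> Utri Vtri e; apply/funext => f; apply/funext => p.
by rewrite Utri Vtri; apply: eq_bigr => m _; rewrite e.
Qed.

Lemma triangularD (U V : op) : triangular U -> triangular V -> triangular (U + V).
Proof.
move=> Utri Vtri f p; rewrite addopE Utri Vtri -big_split.
by apply: eq_bigr => m _; rewrite addopE mulrDr.
Qed.

Lemma triangularN (U : op) : triangular U -> triangular (- U).
Proof.
move=> Utri f p; rewrite oppopE Utri -sumrN.
by apply: eq_bigr => m _; rewrite oppopE mulrN.
Qed.

Lemma fps_sum_xpow (f : fps) (p : mono) :
  f p = \sum_(m <- monos nu (tdeg p)) f$[m] * ('x^m)$[p] :> C.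
Proof.
rewrite (sum_pick (x0 := p)) ?uniq_monos ?mem_monos // ?xpowE ?eqxx ?mulr1 //.
by move=> m _ mp; rewrite xpowE eq_sym (negbTE mp) mulr0.
Qed.

Lemma Xlin_triangular (lambda : 'I_nu -> R[i]) : triangular (Xlin lambda).
Proof.
move=> f p; rewrite XlinE [f p]fps_sum_xpow mulr_sumr.
by apply: eq_bigr => m _; rewrite XlinE mulrCA.
Qed.

(** Multiplication of the homogeneous component of degree n of U by phi n, for
    all n.  Homogeneous components, Theta and the commutator with X_lin are all
    of this form. *)
Definition weighted (phi : degree -> C) (U : op) : op := fun f p =>
  \sum_(m <- monos nu (tdeg p)) phi (degm p - degm m) * (f$[m] * (U ('x^m))$[p]).

Lemma weightedE phi (U : op) : triangular U -> forall m p,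
  weighted phi U ('x^m) p = phi (degm p - degm m) * (U ('x^m))$[p] :> C.
Proof.
move=> Utri m p; rewrite /weighted.
have [mp|pm] := leqP (tdeg m) (tdeg p).
  rewrite (sum_pick (x0 := m)) ?uniq_monos ?mem_monos //.
    by rewrite xpowE eqxx mul1r.
  by move=> a _ am; rewrite xpowE (negbTE am) mul0r mulr0.
rewrite triangular_eq0 // mulr0 big_seq big1 // => a; rewrite mem_monos => ap.
rewrite xpowE; case: eqP => [am|_]; last by rewrite mul0r mulr0.
by rewrite -am ltnNge ap in pm.
Qed.

Lemma weighted_triangular phi (U : op) : triangular U -> triangular (weighted phi U).
Proof.
move=> Utri f p; apply: eq_bigr => m _; rewrite weightedE //.
by rewrite mulrCA.
Qed.

Lemma fpsM_xpow (a b : mono) : fpsM ('x^a) ('x^b) = 'x^((a + b)%R).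
Proof.
apply/funext => p; rewrite xpowE (@fpsM_monos _ _ (tdeg p + tdeg a + tdeg b)); last first.
  by rewrite -addnA leq_addr.
rewrite (sum_pick (x0 := a)) ?uniq_monos ?mem_monos //.
- rewrite (sum_pick (x0 := b)) ?uniq_monos ?mem_monos //.
  + by rewrite !xpowE !eqxx !mulr1 -degmD (inj_eq (@degm_inj nu)) eq_sym.
  + by rewrite leq_addl.
  + by move=> c _ cb; rewrite [('x^b) c]xpowE (negbTE cb) !mulr0.
- by rewrite addnAC leq_addl.
- by move=> c _ ca; rewrite big1 // => d _; rewrite xpowE (negbTE ca) mul0r mulr0.
Qed.

(** Both sides of the Leibniz rule, at a given p, are finite combinations of the
    products f a * g b with coefficients read on monomials. *)
Lemma triangular_leibniz (U : op) : triangular U ->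
  (forall a b, U ('x^((a + b)%R)) = fpsM (U ('x^a)) ('x^b) + fpsM ('x^a) (U ('x^b))) ->
  is_derivation U.
Proof.
move=> Utri leib; split; first exact: triangular_linear.
move=> f g; apply/funext => p; set N := tdeg p.
pose S (F : mono -> mono -> C) := \sum_(a <- monos nu N) \sum_(b <- monos nu N) F a b.
have SE (h k : fps) :
    fpsM h k p = S (fun a b => (degm a + degm b == degm p)%:R * (h$[a] * k$[b])).
  by rewrite (@fpsM_monos _ _ N).
have eqS F G : (forall a b, F a b = G a b) -> S F = S G.
  by move=> e; apply: eq_bigr => a _; apply: eq_bigr => b _.
have swapS (F : mono -> mono -> mono -> mono -> C) :
    S (fun a b => S (fun c d => F a b c d)) = S (fun c d => S (fun a b => F a b c d)).
  rewrite /S; under eq_bigr do rewrite exchange_big.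
  rewrite exchange_big; apply: eq_bigr => c _.
  under eq_bigr do rewrite exchange_big.
  by rewrite exchange_big.
have mulS c F : c * S F = S (fun a b => c * F a b).
  by rewrite /S mulr_sumr; apply: eq_bigr => a _; rewrite mulr_sumr.
have addS F G : S F + S G = S (fun a b => F a b + G a b).
  by rewrite /S -big_split; apply: eq_bigr => a _; rewrite -big_split.
have -> : U (fpsM f g) p = S (fun a b => f$[a] * g$[b] * (U ('x^((a + b)%R)))$[p]).
  rewrite Utri -/N.
  transitivity (\sum_(m <- monos nu N) S (fun a b =>
      (degm a + degm b == degm m)%:R * (f$[a] * g$[b]) * (U ('x^m))$[p])).
    apply: eq_big_seq => m; rewrite mem_monos => mN.
    rewrite (@fpsM_monos _ _ N) // mulr_suml; apply: eq_bigr => a _.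
    by rewrite mulr_suml.
  rewrite /S exchange_big; apply: eq_bigr => a _.
  rewrite exchange_big; apply: eq_bigr => b _.
  have [abN|abN] := boolP ((a + b)%R \in monos nu N).
    rewrite (sum_pick (x0 := (a + b)%R)) ?uniq_monos //.
      by rewrite degmD eqxx mul1r.
    move=> m _ mab; rewrite -degmD (inj_eq (@degm_inj nu)) eq_sym (negbTE mab).
    by rewrite !mul0r.
  rewrite mem_monos -ltnNge in abN.
  rewrite (triangular_eq0 Utri abN) mulr0 big_seq big1 // => m.
  rewrite -degmD (inj_eq (@degm_inj nu)); case: eqP => [<-|_ _].
    by rewrite mem_monos leqNgt abN.
  by rewrite !mul0r.
rewrite addfpsE !SE addS.
under eqS => a b do rewrite leib addfpsE !SE addS mulS.
rewrite swapS; apply: (eqS _ _) => c d.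
have prodS F G : (\sum_(a <- monos nu N) F a) * (\sum_(b <- monos nu N) G b) =
    S (fun a b => F a * G b).
  by rewrite mulr_suml; apply: eq_bigr => a _; rewrite mulr_sumr.
case: eqP => [cdp|_]; last first.
  rewrite !mul0r addr0 /S big1 // => a _; rewrite big1 // => b _.
  by rewrite !mul0r addr0 mulr0.
have [cN dN] : (tdeg c <= N)%N /\ (tdeg d <= N)%N.
  by rewrite /N -(tdeg_add cdp) leq_addr leq_addl.
have fE (h : fps) q : (tdeg q <= N)%N ->
    h q = \sum_(m <- monos nu N) h$[m] * ('x^m)$[q] :> C.
  by move=> qN; apply: (@triangularE id) => // ? ?; exact: fps_sum_xpow.
rewrite (fE f c cN) (fE g d dN) (triangularE f Utri cN) (triangularE g Utri dN).
rewrite !prodS !mul1r addS; apply: eqS => a b.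
by rewrite !mul1r mulrDr; congr (_ + _); rewrite mulrACA.
Qed.

(** On monomials, the three terms of the Leibniz rule at the exponent p involve
    the same degree p - a - b, hence the same factor phi (p - a - b). *)
Lemma weighted_derivation phi (U : op) :
  triangular U -> is_derivation U -> is_derivation (weighted phi U).
Proof.
move=> Utri [_ Uleib]; have wtri := @weighted_triangular phi U Utri.
apply: triangular_leibniz => // a b; apply/funext => p.
rewrite weightedE // -fpsM_xpow Uleib !addfpsE !(@fpsM_monos _ _ (tdeg p)) //.
rewrite -big_split mulr_sumr -big_split; apply: eq_bigr => c _ /=.
rewrite -big_split mulr_sumr -big_split; apply: eq_bigr => d _ /=.
case: eqP => [<-|_]; last by rewrite !mul0r !addr0 mulr0.
rewrite !mul1r mulrDr !weightedE // !xpowE degmD; congr (_ + _).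
  case: eqP => [->|_]; last by rewrite !mulr0.
  by rewrite !mulr1; congr (phi _ * _); rewrite opprD addrACA subrr addr0.
case: eqP => [->|_]; last by rewrite !mul0r mulr0.
by rewrite !mul1r; congr (phi _ * _); rewrite opprD addrACA subrr add0r.
Qed.

Lemma eq_weighted phi psi (U : op) : triangular U ->
  (forall m p, (U ('x^m))$[p] != 0 ->
     phi (degm p - degm m) = psi (degm p - degm m)) ->
  weighted phi U = weighted psi U.
Proof.
move=> Utri e; apply: triangular_ext; try exact: weighted_triangular.
move=> m p; rewrite !weightedE //.
by have [->|/e ->//] := eqVneq (U ('x^m) p) 0; rewrite !mulr0.
Qed.

Lemma weighted1 (U : op) : triangular U -> weighted (fun _ => 1) U = U.
Proof.
move=> Utri; apply: triangular_ext => //; first exact: weighted_triangular.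
by move=> m p; rewrite weightedE // mul1r.
Qed.

Lemma hcomp_weighted (n : degree) (U : op) : triangular U ->
  hcomp n U = weighted (fun k => (k == n)%:R) U.
Proof.
move=> Utri; apply/funext => f; apply/funext => p; rewrite /hcomp.
rewrite (@fsbig_list _ _ _ _ (monos nu (tdeg p))) ?uniq_monos //; last first.
  move=> m _; rewrite mem_monos leqNgt; apply: contra => pm.
  by rewrite triangular_eq0 // mulr0.
rewrite big_mkcond /=; apply: eq_bigr => m _.
rewrite subr_eq; case: ifPn => [/set_mem /= ->|nmp].
  by rewrite eqxx mul1r.
case: eqP => [e|_]; last by rewrite mul0r.
by case/negP: nmp; apply/mem_set/esym.
Qed.

(** At the coefficient p only the degrees p - m, with m of total degree at most
    that of p, contribute: the sum over S has finite support there. *)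
Lemma op_sum_hcomp (S : set degree) (c : degree -> C) (U : op) : triangular U ->
  op_sum S (fun n f => c n *: hcomp n U f) =
  weighted (fun n => if n \in S then c n else 0) U.
Proof.
move=> Utri; apply/funext => f; apply/funext => p; rewrite /op_sum.
have hE n : (c n *: hcomp n U f) p =
    \sum_(m <- monos nu (tdeg p))
      (degm p - degm m == n)%:R * (c n * (f$[m] * (U ('x^m))$[p])) :> C.
  rewrite scalefpsE hcomp_weighted // mulr_sumr; apply: eq_bigr => m _.
  by rewrite mulrCA.
have sub_inj : injective (fun m : mono => degm p - degm m).
  by move=> a b /addrI/oppr_inj/degm_inj.
rewrite (@fsbig_list _ _ _ _ [seq degm p - degm m | m <- monos nu (tdeg p)]).
- rewrite big_map big_mkcond /=; apply: eq_big_seq => m mp.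
  case: ifP => _; last by rewrite mul0r.
  rewrite hE (sum_pick (x0 := m)) ?uniq_monos ?eqxx ?mul1r //.
  by move=> a _ am; rewrite (inj_eq sub_inj) (negbTE am) mul0r.
- by rewrite map_inj_uniq ?uniq_monos.
- move=> n _; apply: contra_neqT => /mapP nin; rewrite hE big_seq big1 // => m mp.
  by case: eqP => [e|_]; [case: nin; exists m|rewrite mul0r].
Qed.

End Triangular.

(** * Exponentials of operators raising the degree *)

Section Exponential.
Set Implicit Arguments.
Unset Strict Implicit.
Context (R : realType) (nu : nat).
Local Notation C := (R[i]).
Local Notation "f $[ p ]" := (f p : R[i]) (at level 2, only parsing).
Local Notation mono := (mono nu).
Local Notation fps := (fps R nu).
Local Notation op := (op R nu).
Local Notation "''x^' m" := (xpow R (degm m)) (at level 3, m at level 2).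

Lemma triangular_local (U : op) (f g : fps) (p : mono) : triangular U ->
  (forall q, (tdeg q <= tdeg p)%N -> f q = g q) -> U f p = U g p.
Proof.
move=> Utri fg; rewrite !Utri; apply: eq_big_seq => m; rewrite mem_monos => mp.
by rewrite fg.
Qed.

Lemma triangular_comp (U V : op) : triangular U -> triangular V -> triangular (U \o V).
Proof.
move=> Utri Vtri f p /=.
have -> : U (V f) p = U (\sum_(a <- monos nu (tdeg p)) (f$[a] *: V ('x^a))) p.
  apply: triangular_local => // q qp.
  rewrite sumfpsE (triangularE f Vtri qp).
  by apply: eq_bigr => a _; rewrite scalefpsE.
have Ulin := triangular_linear Utri.
rewrite linear_sum // sumfpsE; apply: eq_bigr => a _.
by rewrite linear_scale // scalefpsE.
Qed.

Lemma triangular_iter (U : op) k : triangular U -> triangular (iter k U).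
Proof.
move=> Utri; elim: k => [|k IHk]; first by move=> f p; exact: fps_sum_xpow.
exact: triangular_comp.
Qed.

(** Strictly lower triangular for the total degree, hence locally nilpotent. *)
Definition raising (U : op) := triangular U /\
  forall m p : mono, (tdeg p <= tdeg m)%N -> U ('x^m) p = 0.

Lemma raisingN (U : op) : raising U -> raising (- U).
Proof.
move=> [Utri U0]; split; first exact: triangularN.
by move=> m p mp; rewrite oppopE U0 // oppr0.
Qed.

Lemma raising_iter (U : op) k (f : fps) (p : mono) :
  raising U -> (tdeg p < k)%N -> iter k U f p = 0.
Proof.
move=> [Utri U0]; elim: k p => // k IHk p pk.
rewrite iterS Utri big_seq big1 // => m; rewrite mem_monos => mp.
have [pm|mp'] := leqP (tdeg p) (tdeg m); first by rewrite U0 // mulr0.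
by rewrite IHk ?mul0r // (leq_trans mp').
Qed.

Lemma op_expE (T : op) (N : nat) (f : fps) (p : mono) :
  raising T -> (tdeg p < N)%N ->
  op_exp T f p = \sum_(k < N) (k`!%:R)^-1 * (iter k T f)$[p] :> C.
Proof.
move=> Trai pN; rewrite /op_exp /op_sum.
rewrite (@fsbig_list _ _ _ _ (iota 0 N)) ?iota_uniq //; last first.
  move=> k _; rewrite mem_iota add0n leq0n /= ltnNge; apply: contra => Nk.
  by rewrite scalefpsE raising_iter ?mulr0 // (leq_trans pN).
rewrite big_mkcond /= -[N in iota _ N]subn0 big_mkord.
apply: eq_bigr => k _; rewrite ifT ?scalefpsE //; exact/mem_set.
Qed.

Lemma op_exp_triangular (T : op) : raising T -> triangular (op_exp T).
Proof.
move=> Trai f p; have [Ttri _] := Trai.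
rewrite (op_expE _ Trai (ltnSn _)).
under [RHS]eq_bigr => m _ do rewrite (op_expE _ Trai (ltnSn _)) mulr_sumr.
rewrite exchange_big; apply: eq_bigr => k _.
rewrite (triangular_iter k Ttri f p) mulr_sumr; apply: eq_bigr => m _.
by rewrite mulrCA.
Qed.

Lemma iter_opp (T : op) k (f : fps) : linear T ->
  iter k (- T) f = ((-1) ^+ k : C) *: iter k T f.
Proof.
move=> Tlin; elim: k => [|k IHk]; first by rewrite expr0 scale1r.
rewrite !iterS IHk [(- T) _]/(- T _) linear_scale // exprS -scalerA scaleN1r.
by [].
Qed.

Lemma invfact_binomial (n i : nat) : (i <= n)%N ->
  (i`!%:R)^-1 * ((n - i)`!%:R)^-1 = (n`!%:R)^-1 * 'C(n, i)%:R :> C.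
Proof.
move=> le_in; rewrite -(bin_fact le_in) !natrM !invfM [RHS]mulrAC.
by rewrite mulVf ?mul1r // pnatr_eq0 -lt0n bin_gt0.
Qed.

(** The binomial theorem for (1 - 1)^k, once the double sum is arranged by k. *)
Lemma op_expK (T : op) : raising T -> forall f, op_exp T (op_exp (- T) f) = f.
Proof.
move=> Trai f; apply/funext => p; have [Ttri _] := Trai.
have Tlin := triangular_linear Ttri.
pose N := (tdeg p).+1.
have pN : (tdeg p < N)%N by [].
pose h : fps := \sum_(j < N) (((-1) ^+ j / j`!%:R) : C) *: iter j T f.
have hE q : (tdeg q <= tdeg p)%N -> op_exp (- T) f q = h q.
  move=> qp; rewrite (op_expE _ (raisingN Trai) (qp : (tdeg q < N)%N)).
  rewrite /h sumfpsE.
  apply: eq_bigr => j _; rewrite iter_opp // !scalefpsE mulrA.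
  by congr (_ * _); rewrite mulrC.
rewrite (triangular_local (op_exp_triangular Trai) hE) (op_expE _ Trai pN).
pose F i j : C := (i`!%:R)^-1 * ((-1) ^+ j / j`!%:R) * (iter (i + j) T f)$[p].
transitivity (\sum_(i < N) \sum_(j < N) F i j).
  apply: eq_bigr => i _; have iterlin := triangular_linear (triangular_iter i Ttri).
  rewrite /h (linear_sum iterlin) sumfpsE mulr_sumr; apply: eq_bigr => j _.
  by rewrite (linear_scale iterlin) scalefpsE mulrA /F iterD.
rewrite sum_triangle; last first.
  by move=> i j ij; rewrite /F raising_iter // mulr0.
rewrite big_ord_recl big_ord1 /F /= expr0 fact0 divr1 invr1 !mul1r.
rewrite big1 ?addr0 // => k _.
change (bump 0 k) with k.+1.
transitivity (\sum_(i < k.+2)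
    ((-1) ^+ (k.+1 - i) * 1 ^+ i *+ 'C(k.+1, i)) *
    ((k.+1`!%:R)^-1 * (iter k.+1 T f)$[p]) : C).
  apply: eq_bigr => i _; have ik : (i <= k.+1)%N by rewrite -ltnS.
  rewrite subnKC // expr1n mulr1 !mulrA; congr (_ * _).
  rewrite mulrAC invfact_binomial // [LHS]mulrC -[in RHS]mulr_natr -[RHS]mulrA.
  by congr (_ * _); exact: mulrC.
by rewrite -mulr_suml -exprDn addNr expr0n mul0r.
Qed.

(** The iterated Leibniz rule for T^k / k!, summed over k; the terms of total
    exponent larger than that of p vanish at p since T raises the degree. *)
Lemma op_exp_mul (T : op) : raising T -> is_derivation T ->
  forall f g, op_exp T (fpsM f g) = fpsM (op_exp T f) (op_exp T g).
Proof.
move=> Trai [Tlin Tleib] f g; apply/funext => p; pose N := (tdeg p).+1.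
pose u k : fps := ((k`!%:R)^-1 : C) *: iter k T f.
pose v k : fps := ((k`!%:R)^-1 : C) *: iter k T g.
have TS k (h : fps) : T (((k`!%:R)^-1 : C) *: iter k T h) =
    (k.+1%:R : C) *: ((((k.+1)`!%:R)^-1 : C) *: iter k.+1 T h).
  rewrite linear_scale // scalerA factS natrM invfM mulrA mulfV ?mul1r //.
have leibk k : ((k`!%:R)^-1 : C) *: iter k T (fpsM f g) =
    \sum_(i < k.+1) fpsM (u i) (v (k - i)%N).
  elim: k => [|k IHk]; first by rewrite big_ord1 /u /v /= fact0 invr1 !scale1r.
  apply: (@scalerI _ _ (k.+1%:R : C)); first by rewrite pnatr_eq0.
  rewrite -TS IHk linear_sum // scaler_sumr.
  transitivity (\sum_(i < k.+1) ((i.+1%:R : C) *: fpsM (u i.+1) (v (k - i)%N)) +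
                \sum_(i < k.+1) (((k.+1 - i)%:R : C) *: fpsM (u i) (v (k.+1 - i)%N))).
    rewrite -big_split; apply: eq_bigr => i _.
    by rewrite Tleib TS TS fpsMZl (fpsMZr (k - i).+1%:R) -subSn // -ltnS.
  transitivity (\sum_(i < k.+2) ((i%:R : C) *: fpsM (u i) (v (k.+1 - i)%N)) +
                \sum_(i < k.+2) (((k.+1 - i)%:R : C) *: fpsM (u i) (v (k.+1 - i)%N))).
    congr (_ + _).
      by rewrite [RHS]big_ord_recl scale0r add0r; apply: eq_bigr.
    by rewrite [RHS]big_ord_recr /= subnn scale0r addr0.
  rewrite -big_split; apply: eq_bigr => i _ /=.
  by rewrite -scalerDl -natrD subnKC // -ltnS.
have vanish (h : fps) q i : (tdeg q < i)%N -> ((((i`!%:R)^-1 : C) *: iter i T h) q) = 0.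
  by move=> qi; rewrite scalefpsE raising_iter ?mulr0.
have expE (h : fps) q : (tdeg q <= tdeg p)%N ->
    op_exp T h q = (\sum_(i < N) ((i`!%:R)^-1 : C) *: iter i T h) q.
  move=> qp; rewrite (op_expE _ Trai (qp : (tdeg q < N)%N)) sumfpsE.
  by apply: eq_bigr => i _; rewrite scalefpsE.
rewrite expE //; under eq_bigr do rewrite leibk.
have -> : fpsM (op_exp T f) (op_exp T g) p =
    fpsM (\sum_(i < N) u i) (\sum_(i < N) v i) p.
  rewrite !(@fpsM_monos _ _ (tdeg p)) //; apply: eq_big_seq => a.
  rewrite mem_monos => ap; apply: eq_big_seq => b; rewrite mem_monos => bp.
  by rewrite !expE.
have -> : fpsM (\sum_(i < N) u i) (\sum_(i < N) v i) =
    \sum_(i < N) \sum_(j < N) fpsM (u i) (v j).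
  rewrite (big_morph (fun h => fpsM h _) (fun a b => fpsMDl a b _) (fpsM0l _)).
  apply: eq_bigr => i _.
  by rewrite (big_morph (fpsM _) (fpsMDr _) (fpsM0r _)).
rewrite !sumfpsE.
under [RHS]eq_bigr do rewrite sumfpsE.
rewrite [LHS](eq_bigr _ (fun k _ => sumfpsE _ _ _ p)).
symmetry; apply: (sum_triangle (F := fun i j => fpsM (u i) (v j) p : C)) => i j ij.
rewrite (@fpsM_monos _ _ (tdeg p)) //.
rewrite big1 // => a _; rewrite big1 // => b _.
case: eqP => [/tdeg_add ab|]; last by rewrite mul0r.
have [ai|ia] := ltnP (tdeg a) i; first by rewrite [u i a]vanish // mul0r mulr0.
rewrite [v j b]vanish ?mulr0 //; rewrite /N -ab in ij.
by rewrite -(ltn_add2l (tdeg a)) (leq_trans ij) // leq_add2r.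
Qed.

Lemma op_exp_conj_derivation (T U : op) :
  raising T -> is_derivation T -> triangular U -> is_derivation U ->
  is_derivation (op_exp T \o U \o op_exp (- T)).
Proof.
move=> Trai Tder Utri [_ Uleib].
have [Etri Etri'] := (op_exp_triangular Trai, op_exp_triangular (raisingN Trai)).
have T'der : is_derivation (- T).
  case: Tder => Tlin Tleib; split; first exact/triangular_linear/(raisingN Trai).1.
  have oppE h : (- T) h = (-1 : C) *: T h by rewrite scaleN1r.
  by move=> f g; rewrite !oppE Tleib fpsMZl fpsMZr scalerDr.
split; first by apply/triangular_linear/triangular_comp => //; exact: triangular_comp.
move=> f g /=; rewrite op_exp_mul ?Uleib //; last exact: raisingN.
rewrite linear_add; last exact: triangular_linear.
by rewrite !op_exp_mul // !op_expK.
Qed.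

End Exponential.

(** * Moulds and their filtration by length *)

Section Moulds.
Set Implicit Arguments.
Unset Strict Implicit.
Context (L : Type) (F : fieldType).
Local Notation mld := (seq L -> F).
Implicit Types (M N T : mld) (s : seq L).

(** The value at s is the sum of M u * N v over all factorizations s = u v.  The
    recursion removes the first letter, the factor u = [::] giving the first
    term; proofs about it are by induction on s with M generalized. *)
Fixpoint mmul M N s : F :=
  if s is a :: t then M [::] * N s + mmul (fun u => M (a :: u)) N t
  else M [::] * N [::].

Definition mone : mld := fun s => if s is [::] then 1 else 0.

Definition mpow M k : mld := iter k (mmul M) mone.

(** The sum may stop at size s: if M [::] = 0, higher powers vanish at s. *)
Definition mexp M : mld := fun s =>
  \sum_(k < (size s).+1) (k`!%:R)^-1 * mpow M k s.

Definition vanishes_below d M := forall s, (size s < d)%N -> M s = 0.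

Lemma addmE M N s : (M + N) s = M s + N s.
Proof. by []. Qed.

Lemma oppmE M s : (- M) s = - M s.
Proof. by []. Qed.

Lemma submE M N s : (M - N) s = M s - N s.
Proof. by []. Qed.

Lemma mmulBl M M' N : mmul (M - M') N = mmul M N - mmul M' N.
Proof.
apply/funext => s; elim: s M M' => [|a t IHt] M M'.
  by rewrite submE /= mulrBl.
rewrite submE /= -[fun u => _]/((fun u => M (a :: u)) - (fun u => M' (a :: u))).
by rewrite IHt !submE mulrBl opprD addrACA.
Qed.

Lemma mmulBr M N N' : mmul M (N - N') = mmul M N - mmul M N'.
Proof.
apply/funext => s; elim: s M => [|a t IHt] M.
  by rewrite submE /= mulrBr.
by rewrite submE /= IHt !submE mulrBr opprD addrACA.
Qed.

Lemma mmul0l N : mmul 0 N = 0.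
Proof. by have := mmulBl 0 0 N; rewrite !subrr. Qed.

Lemma mmul1l N : mmul mone N = N.
Proof.
apply/funext => -[|a t] /=; rewrite mul1r //.
by rewrite -[fun u => _]/(0 : mld) mmul0l addr0.
Qed.

Lemma mmul1r M : mmul M mone = M.
Proof.
apply/funext => s; elim: s M => [|a t IHt] M /=; first by rewrite mulr1.
by rewrite IHt mulr0 add0r.
Qed.

Lemma vanishes_belowW c d M : (c <= d)%N -> vanishes_below d M -> vanishes_below c M.
Proof. by move=> cd Md s sc; apply: Md; exact: leq_trans cd. Qed.

Lemma vanishes_belowD d M N :
  vanishes_below d M -> vanishes_below d N -> vanishes_below d (M + N).
Proof. by move=> Md Nd s sd; rewrite addmE Md // Nd // addr0. Qed.

Lemma vanishes_belowN d M : vanishes_below d M -> vanishes_below d (- M).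
Proof. by move=> Md s sd; rewrite oppmE Md // oppr0. Qed.

Lemma vanishes_below_mmul c d M N :
  vanishes_below c M -> vanishes_below d N -> vanishes_below (c + d) (mmul M N).
Proof.
move=> Mc Nd s; elim: s c M Mc => [|a t IHt] c M Mc /= scd.
  case: c Mc scd => [|c] Mc scd; last by rewrite Mc // mul0r.
  by rewrite Nd // mulr0.
have -> : M [::] * N (a :: t) = 0.
  case: c Mc scd => [|c] Mc scd; last by rewrite Mc // mul0r.
  by rewrite Nd // mulr0.
rewrite add0r; apply: (IHt c.-1); first by move=> u uc; apply: Mc; case: (c) uc.
by case: (c) scd => [|c'] //= tc; exact: ltnW.
Qed.

Lemma vanishes_below_mpow d T k : vanishes_below d T -> vanishes_below (k * d) (mpow T k).
Proof.
by move=> Td; elim: k => [//|k IHk]; rewrite mulSn; exact: vanishes_below_mmul.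
Qed.

(** The k-th power of T vanishes below length k (d + 1), which is at least d + 2
    for k >= 2. *)
Lemma mexp_first_order d T : vanishes_below d.+1 T ->
  vanishes_below d.+2 (mexp T - mone - T).
Proof.
move=> Td s sd; rewrite !submE /mexp.
case: s sd => [|a t] sd.
  by rewrite big_ord1 /mpow /= fact0 invr1 mul1r subrr (Td [::]) // oppr0 addr0.
rewrite -(big_mkord xpredT (fun k => (k`!%:R)^-1 * mpow T k (a :: t))).
rewrite 2?big_ltn // big_nat_cond big1 ?addr0; last first.
  move=> k /andP[/andP[k2 _] _].
  rewrite (vanishes_below_mpow (d := d.+1)) ?mulr0 //.
  by apply: (leq_trans sd); nia.
by rewrite [mpow T 1]mmul1r fact0 invr1 !mul1r /= subr0 add0r subrr.
Qed.

Section Simplification.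
(* omega s stands for s.lambda, the eigenvalue of ad X_lin on D_s. *)
Variable omega : seq L -> F.

(** The mould of the commutator of X_lin with the operator of mould M. *)
Definition mnabla M : mld := fun s => omega s * M s.

Definition mres M : mld := fun s => if omega s == 0 then M s else 0.

(** The mould of Theta for the field X_lin + M. *)
Definition mtheta M : mld := fun s => if omega s == 0 then 0 else (omega s)^-1 * M s.

(** The mould of exp(T) (X_lin + M) exp(-T) - X_lin, with
    exp(T) X_lin exp(-T) = X_lin + exp(T) [X_lin, exp(-T)]. *)
Definition msam M : mld :=
  let E := mexp (mtheta M) in let E' := mexp (- mtheta M) in
  mmul E (mmul M E') + mmul E (mnabla E').

Definition mlength1 : mld := fun s => (size s == 1)%:R.

Definition msam_iter k : mld := iter k msam mlength1.

(** msam_iter k is constant at s once k is at least the length of s, see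
    msam_iter_tram; so this is its pointwise limit. *)
Definition mtram : mld := fun s => msam_iter (size s) s.

Lemma vanishes_below_nabla d M : vanishes_below d M -> vanishes_below d (mnabla M).
Proof. by move=> Md s sd; rewrite /mnabla Md // mulr0. Qed.

Lemma mnablaB M N : mnabla (M - N) = mnabla M - mnabla N.
Proof. by apply/funext => s; rewrite submE /mnabla submE mulrBr. Qed.

Lemma mnablaN M : mnabla (- M) = - mnabla M.
Proof. by apply/funext => s; rewrite oppmE /mnabla oppmE mulrN. Qed.

(** T solves the linearized conjugacy equation: the term [T, X_lin] of first
    order in the conjugation cancels the nonresonant part of M. *)
Lemma mres_nabla M : M - mnabla (mtheta M) = mres M.
Proof.
apply/funext => s; rewrite submE /mnabla /mtheta /mres.
by case: eqP => [|/eqP w0]; rewrite ?mulr0 ?subr0 // mulVKf ?subrr.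
Qed.

Lemma mnabla1 : omega [::] = 0 -> mnabla mone = 0.
Proof. by move=> w0; apply/funext => -[|a s]; rewrite /mnabla ?w0 ?mul0r ?mulr0. Qed.

Lemma vanishes_below_theta d M :
  vanishes_below d (M - mres M) -> vanishes_below d (mtheta M).
Proof.
move=> Md s sd; have := Md s sd; rewrite submE /mres /mtheta.
by case: eqP => // _; rewrite subr0 => ->; rewrite mulr0.
Qed.

Lemma vanishes_below_res d M : vanishes_below d M -> vanishes_below d (mres M).
Proof. by move=> Md s sd; rewrite /mres Md // if_same. Qed.

Hypothesis omega_nil : omega [::] = 0.

(** With E = exp(T) and E' = exp(-T), the difference is a sum of terms with a
    factor E - 1 or E' - 1, of order d + 1, and a further factor of order at
    least 1, and of nabla (E' - 1 + T), of second order in T. *)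
Lemma msam_first_order d M : vanishes_below 1 M ->
  vanishes_below d.+1 (M - mres M) -> vanishes_below d.+2 (msam M - mres M).
Proof.
move=> M1 /vanishes_below_theta; set T := mtheta M => Td.
have E2 := mexp_first_order Td; have E2' := mexp_first_order (vanishes_belowN Td).
set E := mexp T in E2; set E' := mexp (- T) in E2'.
have E1 : vanishes_below d.+1 (E - mone).
  rewrite -(subrK T (E - mone)); apply: vanishes_belowD => //.
  exact: vanishes_belowW E2.
have E1' : vanishes_below d.+1 (E' - mone).
  rewrite -(subrK (- T) (E' - mone)); apply: vanishes_belowD; last exact: vanishes_belowN.
  exact: vanishes_belowW E2'.
have nE' : mnabla E' = mnabla (E' - mone) by rewrite mnablaB mnabla1 ?subr0.
have -> : msam M - mres M =
    mmul (E - mone) (mmul M E') + mmul M (E' - mone) +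
    (mmul (E - mone) (mnabla E') + mnabla (E' - mone - - T)).
  rewrite -mres_nabla /msam -/T -/E -/E' !mmulBl mmulBr !mmul1l mmul1r.
  rewrite mnablaB -nE' mnablaN opprK !subrKA opprB.
  by rewrite [mnabla T - M]addrC addrACA.
have M0 : vanishes_below 1 (mres M) by exact: vanishes_below_res.
have ME' : vanishes_below 0 (mmul M E') by [].
have nE'd : vanishes_below d.+1 (mnabla E').
  by rewrite nE'; exact: vanishes_below_nabla.
apply: vanishes_belowD; apply: vanishes_belowD.
- rewrite -addn1; apply: vanishes_below_mmul => //.
  by rewrite -[1%N]addn0; exact: vanishes_below_mmul.
- by rewrite -add1n; exact: vanishes_below_mmul.
- apply: (@vanishes_belowW _ (d.+1 + d.+1)); first by lia.
  exact: vanishes_below_mmul.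
- exact: vanishes_below_nabla.
Qed.

(** The resonant part of the new mould differs from that of the old one only
    beyond length k + 1, so the gain of one unit in msam_first_order passes to
    the nonresonant part. *)
Lemma msam_iter_order k : vanishes_below 1 (msam_iter k) /\
  vanishes_below k.+1 (msam_iter k - mres (msam_iter k)).
Proof.
elim: k => [|k [IH1 IHk]].
  have M1 : vanishes_below 1 mlength1 by case.
  split=> //; apply: vanishes_belowD => //.
  exact/vanishes_belowN/vanishes_below_res.
have -> : msam_iter k.+1 = msam (msam_iter k) by [].
move: (msam_iter k) IH1 IHk => M IH1 IHk.
have S2 := msam_first_order IH1 IHk.
move: (msam M) S2 => S S2; split.
  have -> : S = S - mres M + mres M by rewrite subrK.
  apply: vanishes_belowD.
    exact: vanishes_belowW S2.
  exact: vanishes_below_res.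
have -> : S - mres (S) =
    (S - mres M) - mres (S - mres M).
  apply/funext => s; rewrite !submE /mres !submE.
  by case: eqP => _; rewrite ?subr0 // !subrr.
by apply: vanishes_belowD => //; exact/vanishes_belowN/vanishes_below_res.
Qed.

Lemma msam_iter_step k s : (size s <= k)%N -> msam_iter k.+1 s = msam_iter k s.
Proof.
move=> sk; have [M1 Mk] := msam_iter_order k.
have := msam_first_order M1 Mk (leqW sk : (size s < k.+2)%N).
have := Mk s sk; rewrite !submE => /subr0_eq -> /subr0_eq <-.
by [].
Qed.

Lemma msam_iter_tram k s : (size s <= k)%N -> msam_iter k s = mtram s.
Proof.
rewrite /mtram => /subnKC <-; elim: (k - size s)%N => [|j IHj]; first by rewrite addn0.
by rewrite addnS msam_iter_step ?leq_addr.
Qed.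

Lemma mtram_resonant s : omega s != 0 -> mtram s = 0.
Proof.
move=> w0; have [_ Mk] := msam_iter_order (size s).
by have := Mk s (leqnn _); rewrite submE /mres (negbTE w0) subr0.
Qed.

Lemma mtram_nil : mtram [::] = 0.
Proof. by []. Qed.

End Simplification.

End Moulds.

(** * Substituting a homogeneous family in a mould *)

Section Words.
Set Implicit Arguments.
Unset Strict Implicit.
Context (R : realType) (nu : nat) (A : set (degree nu)).
Local Notation C := (R[i]).
Local Notation "f $[ p ]" := (f p : R[i]) (at level 2, only parsing).
Local Notation mono := (mono nu).
Local Notation degree := (degree nu).
Local Notation fps := (fps R nu).
Local Notation op := (op R nu).
Local Notation "''x^' m" := (xpow R (degm m)) (at level 3, m at level 2).

(** Homogeneity of degree n, together with triangularity, which makes it a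
    statement on all series and not only on monomials. *)
Definition graded (n : degree) (U : op) := triangular U /\
  forall m p : mono, U ('x^m) p != 0 -> n + degm m = degm p.

Lemma graded_supp n (U : op) f p : graded n U -> U f p != 0 ->
  exists2 m, n + degm m = degm p & f m != 0.
Proof.
move=> [Utri Ugr] /eqP Ufp; apply/not_exists2P => none; apply: Ufp.
rewrite Utri big1 // => m _; case: (none m) => [nm|/negP/negPn/eqP ->]; last first.
  by rewrite mul0r.
have [->|/Ugr //] := eqVneq (U ('x^m) p) 0; exact: mulr0.
Qed.

Lemma graded_at n (U : op) f m p : graded n U -> n + degm m = degm p ->
  U f p = f$[m] * (U ('x^m))$[p] :> C.
Proof.
move=> [Utri Ugr] nmp; rewrite (triangularE f Utri (leq_addr (tdeg m) (tdeg p))).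
rewrite (sum_pick (x0 := m)) ?uniq_monos ?mem_monos ?leq_addl // => a _ am.
have [->|/Ugr] := eqVneq (U ('x^a) p) 0; first exact: mulr0.
by rewrite -nmp => /addrI/degm_inj am'; rewrite am' eqxx in am.
Qed.

Lemma graded_out n (U : op) f p : graded n U ->
  ~ (exists m, n + degm m = degm p) -> U f p = 0.
Proof.
move=> Ugr none; apply/eqP/negPn/negP => /(graded_supp Ugr)[m nmp _].
by case: none; exists m.
Qed.

Definition wdeg (s : seq A) : degree := \sum_(a <- s) val a.

Lemma wdeg_cons a s : wdeg (a :: s) = val a + wdeg s.
Proof. by rewrite /wdeg big_cons. Qed.

(** The letters that can occur in a word contributing to the coefficients of
    total degree at most N: these are differences of exponents. *)
Definition letters (N : nat) : seq A :=
  undup (pmap insub [seq degm p - degm m | p <- monos nu N, m <- monos nu N]).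

Fixpoint words (r : seq A) (k : nat) : seq (seq A) :=
  if k is k'.+1 then [::] :: [seq a :: s | a <- r, s <- words r k'] else [:: [::]].

Lemma mem_letters N (a : A) m p : (tdeg m <= N)%N -> (tdeg p <= N)%N ->
  val a + degm m = degm p -> a \in letters N.
Proof.
move=> mN pN amp; rewrite mem_undup mem_pmap_sub; apply/allpairsP.
by exists (p, m); rewrite !mem_monos; split=> //=; rewrite -amp addrK.
Qed.

Lemma mem_words r k (s : seq A) :
  (size s <= k)%N -> all (fun a => a \in r) s -> s \in words r k.
Proof.
elim: k s => [|k IHk] [|a s] //= sk /andP[ar sr].
by rewrite inE /=; apply/allpairsP; exists (a, s); split=> //=; exact: IHk.
Qed.

Lemma size_words r k (s : seq A) : s \in words r k -> (size s <= k)%N.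
Proof.
elim: k s => [|k IHk] s /=; first by rewrite inE => /eqP ->.
by rewrite inE => /predU1P[->//|/allpairsP[[a t] [_ /IHk tk ->]]].
Qed.

Lemma uniq_words r k : uniq r -> uniq (words r k).
Proof.
move=> r_uniq; elim: k => //= k IHk; apply/andP; split.
  by apply/negP => /allpairsP[[a s] []].
by rewrite allpairs_uniq // => -[a s] [b t] _ _ /= [-> ->].
Qed.

Section Family.
Variable D : degree -> op.
Hypothesis Agt0 : forall a : A, 0 < tdegz (val a).
Hypothesis Dgr : forall a : A, graded (val a) (D (val a)).

Definition dword (s : seq A) : op := foldr (fun a U => D (val a) \o U) id s.

Lemma dword_triangular s : triangular (dword s).
Proof.
elim: s => [|a s IHs]; first by move=> f p; exact: fps_sum_xpow.
by apply: triangular_comp => //; exact: (Dgr a).1.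
Qed.

Lemma dword_supp s f p : dword s f p != 0 ->
  exists2 m, wdeg s + degm m = degm p & f m != 0.
Proof.
elim: s p => [|a s IHs] p /=; first by exists p => //; rewrite /wdeg big_nil add0r.
case/(graded_supp (Dgr a)) => m amp /IHs[q sqm fq]; exists q => //.
by rewrite wdeg_cons -addrA sqm.
Qed.

Lemma dword_graded s : graded (wdeg s) (dword s).
Proof.
split=> [|m p]; first exact: dword_triangular.
by case/dword_supp => q <-; rewrite xpowE pnatr_eq0 eqb0 negbK => /eqP ->.
Qed.

(** Reading s from the left, each letter moves the exponent p to one of smaller
    total degree. *)
Lemma dword_finite s f p N : (tdeg p <= N)%N -> dword s f p != 0 ->
  (size s <= tdeg p)%N /\ all (fun a => a \in letters N) s.
Proof.
elim: s p => [|a s IHs] p pN //= /(graded_supp (Dgr a))[m amp sm].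
have mp := tdeg_lt (Agt0 a) amp; have mN := ltnW (leq_trans mp pN).
have [sm' ->] := IHs m mN sm; rewrite (mem_letters mN pN amp).
by split=> //; exact: leq_ltn_trans sm' mp.
Qed.

Definition mould_sum (M : seq A -> C) : op :=
  op_sum setT (fun s f => M s *: dword s f).

Lemma mould_summable (M : seq A -> C) :
  op_summable setT (fun s f => M s *: dword s f).
Proof.
move=> f p; set r := words (letters (tdeg p)) (tdeg p).
apply: (@sub_finite_set _ _ [set` r]); last exact: finite_seq.
move=> s [_]; rewrite scalefpsE mulf_eq0 negb_or => /andP[_].
by case/(dword_finite (leqnn _)) => sp sr; exact: mem_words.
Qed.

(** The bounds N and k are free: an induction on words or on p needs the same
    letters at all exponents and lengths that shrink by one. *)
Lemma mould_sumE M N k f p : (tdeg p <= N)%N -> (tdeg p <= k)%N ->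
  mould_sum M f p =
  \sum_(s <- words (letters N) k) M s * (dword s f)$[p] :> C.
Proof.
move=> pN pk; rewrite /mould_sum /op_sum.
rewrite (@fsbig_list _ _ _ _ (words (letters N) k)).
- by rewrite big_mkcond; apply: eq_bigr => s _; rewrite ifT //; exact: mem_set.
- by rewrite uniq_words // undup_uniq.
- move=> s _; rewrite scalefpsE mulf_eq0 negb_or => /andP[_].
  by case/(dword_finite pN) => sp sr; rewrite mem_words // (leq_trans sp).
Qed.

Lemma mould_sum_triangular M : triangular (mould_sum M).
Proof.
move=> f p; rewrite (mould_sumE M f (leqnn (tdeg p)) (leqnn (tdeg p))).
under [RHS]eq_bigr => m _ do
  rewrite (mould_sumE M ('x^m) (leqnn (tdeg p)) (leqnn (tdeg p))) mulr_sumr.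
rewrite exchange_big; apply: eq_bigr => s _.
rewrite dword_triangular mulr_sumr; apply: eq_bigr => m _.
by rewrite mulrCA.
Qed.

Lemma mould_sum_eq M M' f p :
  (forall s, (size s <= tdeg p)%N -> M s = M' s) ->
  mould_sum M f p = mould_sum M' f p.
Proof.
move=> e; rewrite !(mould_sumE _ _ (leqnn (tdeg p)) (leqnn (tdeg p))).
by apply: eq_big_seq => s /size_words /e ->.
Qed.

Lemma mould_sum0 f : mould_sum 0 f = 0.
Proof.
apply/funext => p; rewrite (mould_sumE _ _ (leqnn (tdeg p)) (leqnn (tdeg p))).
by rewrite big1 // => s _; rewrite mul0r.
Qed.

Lemma mould_sumD M N f : mould_sum (M + N) f = mould_sum M f + mould_sum N f.
Proof.
apply/funext => p; rewrite addfpsE !(mould_sumE _ _ (leqnn (tdeg p)) (leqnn (tdeg p))).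
by rewrite -big_split; apply: eq_bigr => s _; rewrite addmE mulrDl.
Qed.

Lemma mould_sumZ c M f : mould_sum (fun s => c * M s) f = c *: mould_sum M f.
Proof.
apply/funext => p; rewrite scalefpsE !(mould_sumE _ _ (leqnn (tdeg p)) (leqnn (tdeg p))).
by rewrite mulr_sumr; apply: eq_bigr => s _; rewrite mulrA.
Qed.

Lemma mould_sumN M f : mould_sum (- M) f = - mould_sum M f.
Proof.
have -> : - M = (fun s => -1 * M s) by apply/funext => s; rewrite mulN1r.
by rewrite mould_sumZ scaleN1r.
Qed.

(** Words are split according to their first letter, which turns the recursive
    definition of the product of moulds into an induction on the exponent p. *)
Lemma mould_sum_rec M f p N : (tdeg p <= N)%N ->
  mould_sum M f p = M [::] * f$[p] +
  \sum_(a <- letters N) (D (val a) (mould_sum (fun s => M (a :: s)) f))$[p] :> C.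
Proof.
move=> pN; rewrite (mould_sumE M f pN (leqW pN)) /= big_cons; congr (_ + _).
rewrite big_allpairs_dep; apply: eq_bigr => a _.
have [[m amp]|none] := pselect (exists m, val a + degm m = degm p); last first.
  have D0 h : D (val a) h p = 0 := graded_out h (Dgr a) none.
  by rewrite D0 big1 // => s _ /=; rewrite D0 mulr0.
have mN : (tdeg m <= N)%N := ltnW (leq_trans (tdeg_lt (Agt0 a) amp) pN).
rewrite (graded_at _ (Dgr a) amp) (mould_sumE _ f mN mN) mulr_suml.
by apply: eq_bigr => s _ /=; rewrite (graded_at _ (Dgr a) amp) mulrA.
Qed.

(** By induction on |p|: after mould_sum_rec, D_a leads to the coefficients at
    p - a of the images of the moulds s -> M (a :: s), and the product of
    moulds obeys the same recursion. *)
Lemma mould_sum_mul M N f : mould_sum (mmul M N) f = mould_sum M (mould_sum N f).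
Proof.
apply/funext => p; have [k] := ubnP (tdeg p); elim: k p M => // k IHk p M pk.
rewrite !(mould_sum_rec _ _ (leqnn (tdeg p))) /= mulrDr -addrA mulrA.
congr (_ + _); rewrite mulr_sumr -big_split; apply: eq_bigr => a _ /=.
have [[m amp]|none] := pselect (exists m, val a + degm m = degm p); last first.
  have D0 h : D (val a) h p = 0 := graded_out h (Dgr a) none.
  by rewrite !D0 mulr0 addr0.
have mp := tdeg_lt (Agt0 a) amp.
have Dat h : D (val a) h p = h$[m] * (D (val a) ('x^m))$[p] :> C.
  exact: graded_at (Dgr a) amp.
rewrite [LHS]Dat [X in _ * X + _]Dat [X in _ + X]Dat mulrA -mulrDl; congr (_ * _).
rewrite -IHk ?(leq_trans mp) //.
rewrite -[fun s : seq A => _]/((fun s => M [::] * N (a :: s)) +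
  mmul (fun s => M (a :: s)) N).
by rewrite mould_sumD mould_sumZ.
Qed.

Lemma mould_sum1 f : mould_sum (mone C) f = f.
Proof.
apply/funext => p; rewrite (mould_sum_rec _ _ (leqnn (tdeg p))) mul1r big1 ?addr0 //.
move=> a _; rewrite [mould_sum _ f](_ : _ = 0); last exact: mould_sum0.
by rewrite linear_zero //; exact/triangular_linear/(Dgr a).1.
Qed.

Lemma mould_sum_pow M k f : mould_sum (mpow M k) f = iter k (mould_sum M) f.
Proof.
elim: k => [|k IHk]; first exact: mould_sum1.
by rewrite [mpow M k.+1]/(mmul M (mpow M k)) mould_sum_mul IHk.
Qed.

Lemma mould_sum_raising M : M [::] = 0 -> raising (mould_sum M).
Proof.
move=> M0; split=> [|m p mp]; first exact: mould_sum_triangular.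
rewrite (mould_sum_rec _ _ (leqnn (tdeg p))) M0 mul0r add0r big1 // => a _.
apply/eqP/negPn/negP => /(graded_supp (Dgr a))[q aqp].
rewrite (triangular_eq0 (mould_sum_triangular _)) ?eqxx //.
exact: leq_trans (tdeg_lt (Agt0 a) aqp) mp.
Qed.

(** At p only words of length at most |p| contribute, and on these both
    exponentials may be truncated after the power |p|. *)
Lemma mould_sum_exp M f : M [::] = 0 ->
  mould_sum (mexp M) f = op_exp (mould_sum M) f.
Proof.
move=> M0; apply/funext => p; have Mrai := mould_sum_raising M0.
rewrite (op_expE _ Mrai (ltnSn _)) (mould_sumE _ _ (leqnn (tdeg p)) (leqnn (tdeg p))).
transitivity (\sum_(s <- words (letters (tdeg p)) (tdeg p))
    \sum_(k < (tdeg p).+1) (k`!%:R)^-1 * mpow M k s * (dword s f)$[p]).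
  apply: eq_big_seq => s /size_words sp; rewrite -mulr_suml; congr (_ * _).
  rewrite /mexp (big_ord_widen _ (fun k => (k`!%:R)^-1 * mpow M k s) (sp : (_ < _.+1)%N)).
  rewrite big_mkcond; apply: eq_bigr => k _; case: ltnP => // sk.
  have M1 : vanishes_below 1 M by case.
  by rewrite (vanishes_below_mpow M1) ?mulr0 // muln1.
rewrite exchange_big; apply: eq_bigr => k _.
rewrite -mould_sum_pow (mould_sumE _ _ (leqnn (tdeg p)) (leqnn (tdeg p))) mulr_sumr.
by apply: eq_bigr => s _; rewrite mulrA.
Qed.

(** D_s is homogeneous of degree wdeg s. *)
Lemma mould_sum_weighted phi M :
  mould_sum (fun s => phi (wdeg s) * M s) = weighted phi (mould_sum M).
Proof.
have Mtri := mould_sum_triangular M.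
apply: triangular_ext; [exact: mould_sum_triangular|exact: weighted_triangular|].
move=> m p; rewrite weightedE // !(mould_sumE _ _ (leqnn (tdeg p)) (leqnn (tdeg p))).
rewrite mulr_sumr; apply: eq_bigr => s _.
have [->|/(dword_graded s).2 <-] := eqVneq (dword s ('x^m) p) 0; first by rewrite !mulr0.
by rewrite addrK mulrA.
Qed.

Lemma mould_sum_letters : mould_sum (@mlength1 A C) = op_sum A D.
Proof.
apply/funext => f; apply/funext => p.
rewrite (mould_sum_rec _ _ (leqnn (tdeg p))) mul0r add0r /op_sum.
rewrite (@fsbig_list _ _ _ _ (map val (letters (tdeg p)))).
- rewrite big_map [RHS]big_mkcond; apply: eq_bigr => a _; rewrite ifT; last exact: valP.
  congr (D _ _ _); rewrite -[RHS]mould_sum1; congr mould_sum.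
  by apply/funext => -[].
- by rewrite map_inj_uniq ?undup_uniq //; exact: val_inj.
- move=> n An Dn; pose a : A := SigSub (mem_set An).
  have [m amp _] := graded_supp (Dgr a) Dn; apply/mapP; exists a => //.
  by apply: (mem_letters _ (leqnn _) amp); exact: ltnW (tdeg_lt (Agt0 a) amp).
Qed.

End Family.

End Words.

(** * Continuity *)

Section Continuity.
Context (R : realType) (nu : nat).

Lemma coef_continuous (n : degree nu) (f : fps R nu) (p : mono nu) :
  continuous (fun D : op_family R nu => (D n f p : R[i]^o)).
Proof.
move=> D; apply: (@continuous_comp _ _ _ (fun E : op_family R nu => E n)
  (fun U : {ptws fps R nu -> {ptws mono nu -> R[i]^o}} => U f p)).
  exact: (@proj_continuous _ (fun=> _) n).
apply: (@continuous_comp _ _ _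
  (fun U : {ptws fps R nu -> {ptws mono nu -> R[i]^o}} => U f)
  (fun g : {ptws mono nu -> R[i]^o} => g p)).
  exact: (@proj_continuous _ (fun=> _) f).
exact: (@proj_continuous _ (fun=> _) p).
Qed.

Lemma add_continuous (T : topologicalType) (F G : T -> R[i]^o) :
  continuous F -> continuous G -> continuous (fun x => F x + G x : R[i]^o).
Proof. by move=> Fcont Gcont x; exact: (cvgD (Fcont x) (Gcont x)). Qed.

Lemma sum_continuous (T : topologicalType) (I : Type) (r : seq I)
    (F : I -> T -> R[i]^o) :
  (forall i, continuous (F i)) ->
  continuous (fun x => \sum_(i <- r) F i x : R[i]^o).
Proof.
move=> Fcont; elim: r => [|i r IHr].
  have -> : (fun x => \sum_(i <- [::]) F i x : R[i]^o) = (fun=> 0).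
    by apply/funext => x; rewrite big_nil.
  exact: cst_continuous.
have -> : (fun x => \sum_(j <- i :: r) F j x : R[i]^o) =
    (fun x => F i x + \sum_(j <- r) F j x).
  by apply/funext => x; rewrite big_cons.
exact: add_continuous.
Qed.

End Continuity.

(** * Fields, their simplification and its limit *)

Section Fields.
Set Implicit Arguments.
Unset Strict Implicit.
Context (R : realType) (nu : nat) (lambda : 'I_nu -> R[i]).
Local Notation C := (R[i]).
Local Notation "f $[ p ]" := (f p : R[i]) (at level 2, only parsing).
Local Notation mono := (mono nu).
Local Notation degree := (degree nu).
Local Notation fps := (fps R nu).
Local Notation op := (op R nu).
Local Notation "''x^' m" := (xpow R (degm m)) (at level 3, m at level 2).
Local Notation Xlin := (Xlin lambda).
Local Notation dotp := (dotp lambda).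

Lemma subopE (U V : op) f : (U - V) f = U f - V f.
Proof. by []. Qed.

Lemma derivationB (U V : op) :
  is_derivation U -> is_derivation V -> is_derivation (U - V).
Proof.
move=> [Ulin Uleib] [Vlin Vleib]; split=> [c f g|f g]; rewrite !subopE.
  by rewrite Ulin Vlin scalerBr opprD addrACA.
rewrite Uleib Vleib.
have NE (h : fps) : - h = (-1 : C) *: h by rewrite scaleN1r.
rewrite !NE fpsMDl fpsMDr fpsMZl fpsMZr scalerDr.
by rewrite addrACA.
Qed.

(** The case e = 2 of derivation_order. *)
Lemma derivation_raising (V : op) : is_derivation V ->
  (forall i q, (tdeg q < 2)%N -> V (xpow R (degX i)) q = 0) -> raising V.
Proof.
move=> Vder Vx.
have V0 (m p : mono) : (tdeg p <= tdeg m)%N -> V ('x^m) p = 0.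
  move=> pm; apply: (derivation_order Vder Vx) => q; rewrite addn2 ltnS => qp.
  by rewrite xpowE; case: eqP => // qm; rewrite -qm leqNgt qp in pm.
split=> // f p; rewrite (derivation_expand Vder f (ltnSn _)).
by rewrite (sum_monos (leqnSn _)) // => m pm; rewrite V0 ?mulr0 // ltnW.
Qed.

Lemma local_field_raising (X : op) : local_field lambda X ->
  is_derivation (X - Xlin) /\ raising (X - Xlin).
Proof.
move=> [Xder Xx]; have Vder := derivationB Xder (Xlin_derivation lambda).
split=> //; apply: derivation_raising => // i q q2.
rewrite subopE addfpsE oppfpsE Xx // XlinE; apply/eqP; rewrite subr_eq0; apply/eqP.
rewrite /xpow; case: eqP => [<-|_]; last by rewrite !mulr0.
rewrite !mulr1 /dotp (bigD1 i) //= big1 ?addr0 => [|j /negbTE ji].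
  by rewrite ffunE eqxx mul1r.
by rewrite ffunE ji mul0r.
Qed.

Lemma homogeneous_graded n (U : op) : 0 < tdegz n ->
  is_derivation U -> homogeneous n U -> graded n U.
Proof.
move=> n0 Uder Uhom.
have Ugr (m p : mono) : U ('x^m) p != 0 -> n + degm m = degm p.
  have [c ->] := Uhom m; rewrite scalefpsE /xpow.
  by case: (_ + _ =P _) => //; rewrite mulr0 eqxx.
split=> // f p; rewrite (derivation_expand Uder f (ltnSn _)).
rewrite (sum_monos (leqnSn _)) // => m pm.
have [->|/Ugr/(tdeg_lt n0)] := eqVneq (U ('x^m) p) 0; first exact: mulr0.
by rewrite ltnNge ltnW.
Qed.

(** The commutator of X_lin multiplies the component of degree n by n.lambda. *)
Lemma Xlin_commute (V : op) f : triangular V ->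
  Xlin (V f) = V (Xlin f) + weighted dotp V f.
Proof.
move=> Vtri; apply/funext => p; rewrite addfpsE XlinE !Vtri mulr_sumr -big_split.
apply: eq_bigr => m _; rewrite XlinE /= -mulrA -mulrDl -dotpD.
by rewrite (addrC (degm m)) subrK.
Qed.

(** The set of degrees over which Theta is a sum may be dropped: a degree that
    does not occur has a zero component. *)
Lemma ThetaE (Y : op) : triangular (Y - Xlin) ->
  Theta lambda Y =
  weighted (fun n => if dotp n == 0 then 0 else (dotp n)^-1) (Y - Xlin).
Proof.
move=> Vtri; rewrite /Theta op_sum_hcomp //; apply: eq_weighted => // m p Vmp.
set n := degm p - degm m; case: ifPn => [/set_mem[_ /negbTE -> //]|nin].
case: eqP => // /eqP n0; case/negP: nin; apply/mem_set; split=> //=.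
apply: contra_neq Vmp => D0.
have := weightedE (fun k => (k == n)%:R) Vtri m p.
rewrite -hcomp_weighted // -[hcomp n (Y - Xlin)]/(Dop lambda Y n) D0 eqxx mul1r.
by move=> <-.
Qed.

Lemma Xsam_derivation (Y : op) : is_derivation Y -> raising (Y - Xlin) ->
  is_derivation (Xsam lambda Y).
Proof.
move=> Yder [Vtri V0]; have Vder := derivationB Yder (Xlin_derivation lambda).
have Tder : is_derivation (Theta lambda Y).
  by rewrite ThetaE //; exact: weighted_derivation.
have Trai : raising (Theta lambda Y).
  rewrite ThetaE //; split=> [|m p mp]; first exact: weighted_triangular.
  by rewrite weightedE // V0 // mulr0.
apply: op_exp_conj_derivation => //.
by rewrite -(subrK Xlin Y); apply: triangularD => //; exact: Xlin_triangular.
Qed.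

Section Components.
Variables (X : op) (hX : local_field lambda X).
Let D := Dop lambda X.
Let A := degrees lambda X.

Lemma Dop_weighted n : D n = weighted (fun k => (k == n)%:R) (X - Xlin).
Proof. exact/hcomp_weighted/(local_field_raising hX).2.1. Qed.

Lemma degrees_gt0 n : A n -> 0 < tdegz n.
Proof.
have [_ [Vtri V0]] := local_field_raising hX.
rewrite /A /degrees /= -/(D n) => Dn; rewrite ltNge; apply: contra_neqN Dn => n0.
rewrite Dop_weighted; apply: triangular_ext.
- exact: weighted_triangular.
- by move=> f p; rewrite big1 // => m _; rewrite mulr0.
- move=> m p; rewrite weightedE //; case: eqP => [e|_]; last by rewrite mul0r.
  rewrite V0 ?mulr0 // -lez_nat -!tdegz_degm -(subrK (degm m) (degm p)) e tdegzD.
  by rewrite gerDr.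
Qed.

Lemma Dop_family : homogeneous_family A D.
Proof.
have [Vder [Vtri V0]] := local_field_raising hX.
move=> n _; rewrite Dop_weighted; split; first exact: weighted_derivation.
move=> m; have [[q nmq]|none] := pselect (exists q, n + degm m = degm q).
  exists ((X - Xlin) ('x^m) q); apply/funext => p.
  rewrite weightedE // scalefpsE /xpow nmq (inj_eq (@degm_inj nu)) subr_eq nmq.
  rewrite (inj_eq (@degm_inj nu)) eq_sym.
  by case: eqP => [->|_]; rewrite ?mul0r ?mulr0 // mulr1 mul1r.
exists 0; rewrite scale0r; apply/funext => p; rewrite weightedE //.
case: eqP => [e|_]; last by rewrite mul0r.
by case: none; exists p; rewrite -e subrK.
Qed.

(** Statements on families thus apply to X itself. *)
Lemma field_of_Dop : field_of lambda A D = X.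
Proof.
have [Vder [Vtri V0]] := local_field_raising hX.
rewrite /field_of.
have -> : op_sum A D = op_sum A (fun n f => (1 : C) *: hcomp n (X - Xlin) f).
  congr op_sum; apply/funext => n; apply/funext => f.
  by rewrite scale1r.
rewrite op_sum_hcomp // (_ : weighted _ _ = X - Xlin); first by rewrite addrC subrK.
rewrite -[RHS]weighted1 //; apply: eq_weighted => // m p Vmp.
rewrite ifT //; apply/mem_set; rewrite /A /degrees /= -/(D _).
apply: contra_neq Vmp => D0.
have := weightedE (fun k => (k == degm p - degm m)%:R) Vtri m p.
by rewrite -Dop_weighted D0 eqxx mul1r => <-.
Qed.

End Components.

Section Universal.
Variable A : set degree.
Hypothesis Agt0 : forall n, A n -> 0 < tdegz n.

Definition weight (s : seq A) : C := dotp (wdeg s).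

Definition Tram : mould R A := mtram weight.

Lemma weight_nil : weight [::] = 0.
Proof.
by rewrite /weight /wdeg big_nil /dotp big1 // => i _; rewrite ffunE mul0r.
Qed.

Section FixedFamily.
Variable D : op_family R nu.
Hypothesis hD : homogeneous_family A D.

Lemma letter_gt0 (a : A) : 0 < tdegz (val a).
Proof. exact/Agt0/set_mem/valP. Qed.

Lemma letter_graded (a : A) : graded (val a) (D (val a)).
Proof.
have Aa : A (val a) by exact/set_mem/valP.
by have [Dder Dhom] := hD Aa; exact: homogeneous_graded (letter_gt0 a) Dder Dhom.
Qed.

Local Notation gt0 := letter_gt0.
Local Notation gr := letter_graded.
Local Notation Phi := (@mould_sum R nu A D).

Lemma Theta_mould (M : seq A -> C) :
  Theta lambda (Xlin + Phi M) = Phi (mtheta weight M).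
Proof.
have e : Xlin + Phi M - Xlin = Phi M by rewrite addrC addKr.
have Mtri := mould_sum_triangular gt0 gr M.
rewrite ThetaE e // -(mould_sum_weighted gt0 gr); congr mould_sum.
by apply/funext => s; rewrite /mtheta /weight; case: eqP => _; rewrite ?mul0r.
Qed.

(** X_lin is not the image of a mould, so it is first moved to the right through
    exp(-Theta), at the cost of the commutator described by mnabla. *)
Lemma Xsam_mould (M : seq A -> C) : M [::] = 0 ->
  Xsam lambda (Xlin + Phi M) = Xlin + Phi (msam weight M).
Proof.
move=> M0; rewrite /Xsam Theta_mould; set T := mtheta weight M.
have T0 : T [::] = 0 by rewrite /T /mtheta weight_nil eqxx.
have NT0 : (- T) [::] = 0 by rewrite oppmE T0 oppr0.
have Trai := mould_sum_raising gt0 gr T0.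
have NE : - Phi T = Phi (- T).
  by apply/funext => f; rewrite (mould_sumN gt0 gr).
have expT f : op_exp (Phi T) f = Phi (mexp T) f by rewrite (mould_sum_exp gt0 gr).
have expNT f : op_exp (- Phi T) f = Phi (mexp (- T)) f.
  by rewrite NE (mould_sum_exp gt0 gr).
have Elin := triangular_linear (mould_sum_triangular gt0 gr (mexp T)).
apply/funext => f /=; rewrite expNT expT.
rewrite -[(Xlin + Phi M) _]/(Xlin _ + Phi M _) -[RHS]/(Xlin f + Phi _ f).
rewrite Xlin_commute; last exact: (mould_sum_triangular gt0 gr).
rewrite -(mould_sum_weighted gt0 gr) !(linear_add Elin) /msam.
rewrite (mould_sumD gt0 gr) !(mould_sum_mul gt0 gr).
rewrite -[X in X + _ + _ = _]expT -expNT (op_expK Trai) -addrA.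
by congr (_ + _); rewrite addrC.
Qed.

Lemma msam_iter_nil k : msam_iter weight k [::] = 0.
Proof. by have [M1 _] := msam_iter_order weight_nil k; exact: M1. Qed.

(** The moulds on the right do not depend on D: this gives both the mould
    expansion and the continuity in D. *)
Lemma Xsam_iter_mould k :
  Xsam_iter lambda k (field_of lambda A D) = Xlin + Phi (msam_iter weight k).
Proof.
elim: k => [|k IHk].
  by rewrite /Xsam_iter /= /field_of -(mould_sum_letters gt0 gr).
have -> : forall Y : op, Xsam_iter lambda k.+1 Y = Xsam lambda (Xsam_iter lambda k Y) by [].
by rewrite IHk Xsam_mould // msam_iter_nil.
Qed.

Lemma Xsam_iter_stationary k f p : (tdeg p <= k)%N ->
  Xsam_iter lambda k (field_of lambda A D) f p = (Xlin + Phi Tram) f p.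
Proof.
move=> pk; rewrite Xsam_iter_mould !addopE; congr (_ + _).
apply: (mould_sum_eq gt0 gr) => s sp; apply: msam_iter_tram; first exact: weight_nil.
exact: leq_trans pk.
Qed.

Lemma Xsam_iter_cvg f p :
  Xsam_iter lambda k (field_of lambda A D) f p @[k --> \oo] --> (Xlin + Phi Tram) f p.
Proof.
apply: cvg_near_cst; exists (tdeg p) => // k /= pk.
exact: Xsam_iter_stationary.
Qed.

Lemma Xtram_mould : Xtram lambda (field_of lambda A D) = Xlin + Phi Tram.
Proof.
apply/funext => f; apply/funext => p; apply: cvg_lim; last exact: Xsam_iter_cvg.
exact: norm_hausdorff.
Qed.

Lemma Xsam_iter_derivation k : is_derivation (field_of lambda A D) ->
  is_derivation (Xsam_iter lambda k (field_of lambda A D)).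
Proof.
move=> Fder; elim: k => // k IHk; apply: (Xsam_derivation IHk).
rewrite Xsam_iter_mould addrC addKr.
exact: (mould_sum_raising gt0 gr (msam_iter_nil k)).
Qed.

(** The Leibniz rule at p involves coefficients of total degree at most |p| only,
    and these are the ones of the derivation X_sam^|p|. *)
Lemma Xtram_local_field : is_derivation (field_of lambda A D) ->
  local_field lambda (Xlin + Phi Tram).
Proof.
move=> Fder; have [Ttri T0] := mould_sum_raising gt0 gr (mtram_nil weight).
split.
  split; first by apply/triangular_linear/triangularD => //; exact: Xlin_triangular.
  move=> f g; apply/funext => p; set N := tdeg p.
  have [_ leib] := Xsam_iter_derivation N Fder.
  rewrite -(@Xsam_iter_stationary N) // leib !addfpsE !(@fpsM_monos _ _ N) //.
  congr (_ + _); apply: eq_big_seq => a; rewrite mem_monos => aN;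
    apply: eq_big_seq => b; rewrite mem_monos => bN.
    by rewrite Xsam_iter_stationary.
  by rewrite Xsam_iter_stationary.
move=> i p p1; pose e : mono := [ffun j => (j == i) : nat].
have -> : degX i = degm e by apply/ffunP => j; rewrite !ffunE.
have e1 : tdeg e = 1%N.
  rewrite /tdeg (bigD1 i) //= ffunE eqxx big1 // => j /negbTE ji.
  by rewrite ffunE ji.
rewrite addopE T0 ?e1 // addr0 XlinE xpowE; case: eqP => [->|_]; last by rewrite !mulr0.
rewrite !mulr1 /dotp (bigD1 i) //= big1 ?addr0 => [|j /negbTE ji].
  by rewrite !ffunE eqxx mul1r.
by rewrite !ffunE ji mul0r.
Qed.

Lemma Xtram_commute : commutator Xlin (Phi Tram) = 0.
Proof.
have Ttri := mould_sum_triangular gt0 gr Tram.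
apply/funext => f; rewrite /commutator -[LHS]/(Xlin (Phi Tram f) - Phi Tram (Xlin f)).
rewrite Xlin_commute // addrC addKr -(mould_sum_weighted gt0 gr).
rewrite (_ : (fun s => _) = 0) ?(mould_sum0 gt0 gr) //.
apply/funext => s; rewrite -[dotp (wdeg s)]/(weight s).
have [->|/(mtram_resonant weight_nil) s0] := eqVneq (weight s) 0; first exact: mul0r.
by rewrite [Tram s]s0 mulr0.
Qed.

End FixedFamily.

(** The coefficient is a product of coefficients D_a (x^m) at p with m and p
    determined by the word.  On arbitrary families, D -> D_a (D_s f) is not
    visibly continuous, hence the auxiliary g. *)
Lemma dword_continuous (s : seq A) (f : fps) (p : mono) :
  exists2 g : op_family R nu -> R[i]^o, continuous g &
    forall D, homogeneous_family A D -> dword D s f p = g D.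
Proof.
elim: s p => [|a s IHs] p.
  by exists (fun=> f p) => // D; exact: cst_continuous.
have [[m amp]|none] := pselect (exists m, val a + degm m = degm p).
  have [g gcont gE] := IHs m.
  exists (fun D => g D * D (val a) ('x^m) p : R[i]^o).
    by move=> D; exact: (cvgM (gcont D) (@coef_continuous R nu (val a) ('x^m) p D)).
  by move=> D hD; rewrite /= (graded_at _ (letter_graded hD a) amp) gE.
exists (fun=> 0) => [D|D hD]; first exact: cst_continuous.
exact: (graded_out _ (letter_graded hD a) none).
Qed.

Lemma Xtram_continuous : depends_continuously lambda A (Xtram lambda).
Proof.
move=> f p; pose r := words (letters A (tdeg p)) (tdeg p).
have /choice[g gP] : forall s : seq A, exists g : op_family R nu -> R[i]^o,
    continuous g /\ forall D, homogeneous_family A D -> dword D s f p = g D.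
  by move=> s; have [g gcont gE] := dword_continuous s f p; exists g.
pose G (D : op_family R nu) : R[i]^o := Xlin f p + \sum_(s <- r) (Tram s : R[i]^o) * g s D.
have Gcont : continuous G.
  have gcont s : continuous (fun D => (Tram s : R[i]^o) * g s D).
    by move=> D; exact: (cvgM (cvg_cst _) ((gP s).1 D)).
  apply: (@add_continuous _ _ (fun=> Xlin f p : R[i]^o)).
    exact: cst_continuous.
  exact: (@sum_continuous R _ _ r (fun s D => (Tram s : R[i]^o) * g s D) gcont).
apply: (@subspace_eq_continuous _ _ _ G); last exact: continuous_subspaceT.
move=> D /set_mem hD; rewrite /from_subspace Xtram_mould // addopE /G; congr (_ + _).
rewrite (mould_sumE letter_gt0 (letter_graded hD) _ _ (leqnn (tdeg p)) (leqnn (tdeg p))).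
by apply: eq_bigr => s _; rewrite (gP s).2.
Qed.

End Universal.

End Fields.

Theorem mainTheorem9 (R : realType) (nu : nat) (lambda : 'I_nu -> R[i])
    (X : op R nu) (hX : local_field lambda X) :
  [/\ (forall (f : fps R nu) (p : mono nu),
         Xsam_iter lambda k X f p @[k --> \oo] --> Xtram lambda X f p),
      prenormal_form lambda (Xtram lambda X),
      depends_continuously lambda (degrees lambda X) (Xtram lambda)
    & exists Tram : mould R (degrees lambda X),
        mould_expansion lambda X (Xtram lambda X) Tram].
Proof.
have Agt0 := degrees_gt0 hX; have hD := Dop_family hX.
have XE := field_of_Dop hX; have XtramE := Xtram_mould lambda Agt0 hD.
have Fder : is_derivation (field_of lambda (degrees lambda X) (Dop lambda X)).
  by rewrite XE; case: hX.
rewrite XE in XtramE; split.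
- move=> f p; rewrite XtramE.
  by have := @Xsam_iter_cvg _ _ lambda _ Agt0 _ hD f p; rewrite XE.
- rewrite XtramE; split; first exact: (Xtram_local_field Agt0 hD Fder).
  by rewrite [_ - _]addrC addKr; exact: Xtram_commute.
- exact: Xtram_continuous.
- exists (Tram lambda (A := degrees lambda X)); split; last exact: XtramE.
  exact: (mould_summable (letter_gt0 Agt0) (letter_graded Agt0 hD)).
Qed.
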